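(* Let $(\beta,N)\in\mathbb{R}^{p+3}$ and for $j\in\{1,\dots,p\}$ define, with $x_{p+1}=N$, $$\mathfrak{L}^x_j=\mathcal{L}_j(x_1,\dots,x_j;\beta_0,\dots,\beta_{j+1};x_{j+1}),\qquad \mu_j(n)=-(n_1+\cdots+n_j)(n_1+\cdots+n_j-1+\beta_{j+1}-\beta_0).$$ Then $$\mathfrak{L}^x_j R_p(n;x;\beta;N)=\mu_j(n)R_p(n;x;\beta;N)$$ for every $j\in\{1,\dots,p\}$ (for all $n\in\mathbb{N}_0^p$ if $N\notin\mathbb{N}_0$, and for all $n\in\mathbb{N}_0^p$ with $|n|\le N$ if $N\in\mathbb{N}_0$), and the operators $\mathfrak{L}^x_1,\dots,\mathfrak{L}^x_p$ commute with each other, i.e. $\mathcal{A}_x=\mathbb{R}[\mathfrak{L}^x_1,\dots,\mathfrak{L}^x_p]$ is a commutative subalgebra of $\mathcal{D}_x$.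
   Context: Notation: $p\ge1$, $x=(x_1,\dots,x_p)$, $x_{p+1}=N$, $\beta=(\beta_0,\dots,\beta_{p+1})\in\mathbb{R}^{p+2}$, $|n|=n_1+\cdots+n_p$, $N_1^j=n_1+\cdots+n_j$, $N_1^0=0$, $(a)_k=a(a+1)\cdots(a+k-1)$. $\mathcal{D}_x$ is the associative algebra of difference operators $\sum_{\nu\in S}l_\nu(x)E_x^\nu$, $S\subset\mathbb{Z}^p$ finite, $l_\nu$ rational functions of $x$, where $E_{x_i}f(x)=f(x+e_i)$ and $E_x^\nu=\prod_i E_{x_i}^{\nu_i}$. The operator $\mathcal{L}_q(x_1,\dots,x_q;\beta_0,\dots,\beta_{q+1};M)$ (for $q\ge1$): Let $\triangle_{x_i}=E_{x_i}-1$, $\nabla_{x_i}=1-E_{x_i}^{-1}$ (with multi-index powers), and for $1\le i\le q$ let $I_i$ be the substitution $x_i\mapsto -x_i-\beta_i$ (everything else fixed) on rational functions. For $\nu\in\{0,1\}^q\setminus\{0\}$ with nonzero components at positions $i_1<\cdots<i_s$ put $$A_\nu=(x_{i_1}+\beta_{i_1}-\beta_0)(x_{i_1}+\beta_{i_1})\,\frac{\prod_{k=2}^s(x_{i_k}+x_{i_{k-1}}+\beta_{i_k})(x_{i_k}+x_{i_{k-1}}+\beta_{i_k}+1)}{\prod_{k=1}^s(2x_{i_k}+\beta_{i_k})(2x_{i_k}+\beta_{i_k}+1)}\,(x_{i_s}+\beta_{q+1}+M)(M-x_{i_s}).$$ With $\nu_j^+=\max(\nu_j,0)$, $\nu_j^-=-\min(\nu_j,0)$,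 for $\nu\in\{-1,0,1\}^q\setminus\{0,1\}^q$ put $A_\nu=I^{\nu^-}(A_{\nu^++\nu^-})$, where $I^{\nu^-}$ is the composition of the $I_i$ with $\nu_i^-=1$. Then $\mathcal{L}_q=\sum_{\nu\in\{-1,0,1\}^q\setminus\{0\}}(-1)^{|\nu^-|}A_\nu\triangle_x^{\nu^+}\nabla_x^{\nu^-}$. Racah polynomials: the one-variable polynomials are $$r_n(\alpha,\beta,\gamma,\delta;x)=(\alpha+1)_n(\beta+\delta+1)_n(\gamma+1)_n\;{}_4F_3\!\left[\begin{matrix}-n,\ n+\alpha+\beta+1,\ -x,\ x+\gamma+\delta+1\\ \alpha+1,\ \beta+\delta+1,\ \gamma+1\end{matrix};1\right],$$ where the denominators of the hypergeometric series are cancelled against the prefactor, i.e. $r_n=\sum_{k=0}^n\frac{(-n)_k(n+\alpha+\beta+1)_k(-x)_k(x+\gamma+\delta+1)_k}{k!}(\alpha+1+k)_{n-k}(\beta+\delta+1+k)_{n-k}(\gamma+1+k)_{n-k}$. The multivariable Racah polynomials are $$R_p(n;x;\beta;N)=\prod_{k=1}^p r_{n_k}\big(2N_1^{k-1}+\beta_k-\beta_0-1,\ \beta_{k+1}-\beta_k-1,\ N_1^{k-1}-x_{k+1}-1,\ N_1^{k-1}+\beta_k+x_{k+1};\ -N_1^{k-1}+x_k\big).$$ *)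

(* Defs.v *)
From HB Require Import structures.
From mathcomp Require Import all_boot all_order all_algebra.
From mathcomp Require Import generic_quotient reals.
From mathcomp Require Export mpoly.

Set Implicit Arguments.
Unset Strict Implicit.
Unset Printing Implicit Defensive.

Import Order.TTheory GRing.Theory Num.Theory.
Local Open Scope ring_scope.

(* The (a)_k of the literature. *)
Definition rising (F : fieldType) (a : F) (k : nat) : F :=
  \prod_(i < k) (a + i%:R).

(* The denominators of the 4F3 series are cancelled against the prefactor
   (a + 1)_n (b + d + 1)_n (c + 1)_n, so nothing is divided except by k!. *)
Definition racah (F : fieldType) (n : nat) (a b c d x : F) : F :=
  \sum_(k < n.+1)
    rising (- n%:R) k * rising (n%:R + a + b + 1) k
    * rising (- x) k * rising (x + c + d + 1) k / k`!%:R
    * rising (a + 1 + k%:R) (n - k) * rising (b + d + 1 + k%:R) (n - k)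
    * rising (c + 1 + k%:R) (n - k).

(* n_1 + ... + n_j: the index i : 'I_p stands for the position i + 1. *)
Definition psum (p : nat) (n : 'I_p -> nat) (j : nat) : nat :=
  (\sum_(i < p | i < j) n i)%N.

(* [x] and [b] are indexed as in x_1, ..., x_p, x_(p+1) = N and
   b_0, ..., b_(p+1); the factor of index k : 'I_p is the one usually
   numbered k + 1. *)
Definition mracah (F : fieldType) (p : nat) (n : 'I_p -> nat) (x b : nat -> F)
    : F :=
  \prod_(k < p)
    let s := (psum n k)%:R in
    racah (n k)
      (2%:R * s + b k.+1 - b 0%N - 1) (b k.+2 - b k.+1 - 1)
      (s - x k.+2 - 1) (s + b k.+1 + x k.+2)
      (- s + x k.+1).

Definition ratfun (R : realType) (p : nat) : fieldType :=
  {fraction {mpoly R[p]}}.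

Definition entry (R : realType) (m : nat) (v : 'rV[R]_m.+1) (k : nat) : R :=
  v 0 (inord k).

Section RationalFunctions.
Context {R : realType} {p : nat}.
Local Notation K := (ratfun R p).
Implicit Types (f : K) (L : K -> K) (k : nat).

Definition cst (c : R) : K := FracField.tofrac (c%:MP : {mpoly R[p]}).

Definition indet (i : 'I_p) : K := FracField.tofrac ('X_i : {mpoly R[p]}).

(* x_k for 1 <= k <= p, and x_(p+1) = N. *)
Definition xvar (N : R) k : K := oapp indet (cst N) (insub k.-1).

(* f(h_1, ..., h_p). The value does not depend on the representative of f
   as soon as the h_i are algebraically independent; below they are
   always images of the variables under an affine automorphism. *)
Definition fsubst (h : 'I_p -> K) f : K :=
  mmap cst h \n_(repr f) / mmap cst h \d_(repr f).

(* f(x) |-> f(x + nu) *)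
Definition shift (nu : 'I_p -> int) : K -> K :=
  fsubst (fun i => indet i + (nu i)%:~R).

Definition unitv k (i : 'I_p) : int := (i.+1 == k)%:R.

Definition Eshift k : K -> K := shift (unitv k).
Definition Eshift_inv k : K -> K := shift (fun i => - unitv k i).

Definition fdiff k f : K := Eshift k f - f.
Definition bdiff k f : K := f - Eshift_inv k f.

(* x_k |-> - x_k - b_k, the other variables being fixed. *)
Definition reflect_var (b : nat -> R) k : K -> K :=
  fsubst (fun i => if i.+1 == k then - indet i - cst (b k) else indet i).

(* Composition of the operators T_(i+1) over the i : 'I_q with nu_i = 1;
   all the families used below consist of commuting operators. *)
Definition opprod (q : nat) (nu : {ffun 'I_q -> bool}) (T : nat -> K -> K)
    : K -> K :=
  \big[@comp K K K/id]_(i < q | nu i) T i.+1.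

Section RacahOperator.
Variables (N : R) (b : nat -> R) (q : nat) (M : K).
Local Notation x := (xvar N).
Local Notation "'B_ k" := (cst (b k)) (at level 8, k at level 2).

(* The increasing sequence i_1 < ... < i_s of positions (numbered from 1)
   of the nonzero components of nu. *)
Definition positions (nu : {ffun 'I_q -> bool}) : seq nat :=
  [seq (nat_of_ord i).+1 | i <- enum 'I_q & nu i].

(* A_nu for nu in {0,1}^q, nu <> 0. *)
Definition coefA01 (nu : {ffun 'I_q -> bool}) : K :=
  let s := size (positions nu) in
  let i k := nth 0%N (positions nu) k.-1 in
  (x (i 1%N) + 'B_(i 1%N) - 'B_0%N) * (x (i 1%N) + 'B_(i 1%N))
  * ((\prod_(2 <= k < s.+1)
        ((x (i k) + x (i k.-1) + 'B_(i k))
         * (x (i k) + x (i k.-1) + 'B_(i k) + 1)))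
     / (\prod_(1 <= k < s.+1)
          ((2%:R * x (i k) + 'B_(i k)) * (2%:R * x (i k) + 'B_(i k) + 1))))
  * (x (i s) + 'B_q.+1 + M) * (M - x (i s)).

(* {-1,0,1} is encoded by 'I_3. *)
Definition sg3 (t : 'I_3) : int := t%:Z - 1.

Definition nonneg_part (nu : {ffun 'I_q -> 'I_3}) : {ffun 'I_q -> bool} :=
  [ffun i => sg3 (nu i) == 1].
Definition nonpos_part (nu : {ffun 'I_q -> 'I_3}) : {ffun 'I_q -> bool} :=
  [ffun i => sg3 (nu i) == -1].

(* A_nu for nu in {-1,0,1}^q, nu <> 0; on {0,1}^q this is coefA01. *)
Definition coefA (nu : {ffun 'I_q -> 'I_3}) : K :=
  opprod (nonpos_part nu) (reflect_var b)
    (coefA01 [ffun i => nonneg_part nu i || nonpos_part nu i]).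

(* L_q(x_1, ..., x_q; b_0, ..., b_(q+1); M) for 1 <= q <= p and M free of
   x_1, ..., x_q; N is only used by xvar and does not occur then, except
   through M. *)
Definition Lop (f : K) : K :=
  \sum_(nu : {ffun 'I_q -> 'I_3} | [exists i, sg3 (nu i) != 0])
    (-1) ^+ (\sum_(i < q) nonpos_part nu i)%N * coefA nu
    * opprod (nonneg_part nu) fdiff (opprod (nonpos_part nu) bdiff f).

End RacahOperator.

Definition Lx (b : nat -> R) (N : R) (j : nat) : K -> K :=
  Lop N b j (xvar N j.+1).

(* The algebra of difference operators is realized as an algebra of operators
   on the field of rational functions, composition being the product; it acts
   faithfully there, distinct shifts being linearly independent over K. *)
Definition is_diffop L : Prop :=
  exists (S : seq {ffun 'I_p -> int}) (l : {ffun 'I_p -> int} -> K),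
    uniq S /\ forall f, L f = \sum_(nu <- S) l nu * shift nu f.

(* The unital algebra of operators generated by G. *)
Inductive gen_algebra (G : (K -> K) -> Prop) : (K -> K) -> Prop :=
| gen_in L : G L -> gen_algebra G L
| gen_one : gen_algebra G id
| gen_scale c L : gen_algebra G L -> gen_algebra G (fun f => cst c * L f)
| gen_add L L' : gen_algebra G L -> gen_algebra G L' ->
    gen_algebra G (fun f => L f + L' f)
| gen_comp L L' : gen_algebra G L -> gen_algebra G L' ->
    gen_algebra G (L \o L')
| gen_ext L L' : L =1 L' -> gen_algebra G L -> gen_algebra G L'.

Record comm_subalgebra (A : (K -> K) -> Prop) : Prop := CommSubalgebra {
  csa_diffop : forall L, A L -> is_diffop L;
  csa_one : A id;
  csa_scale : forall c L, A L -> A (fun f => cst c * L f);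
  csa_add : forall L L', A L -> A L' -> A (fun f => L f + L' f);
  csa_comp : forall L L', A L -> A L' -> A (L \o L');
  csa_comm : forall L L', A L -> A L' -> L \o L' =1 L' \o L
}.

(* R[L_1, ..., L_p] *)
Definition Ax (b : nat -> R) (N : R) : (K -> K) -> Prop :=
  gen_algebra (fun L => exists2 j, (1 <= j <= p)%N & L = Lx b N j).

Definition Rp (n : 'I_p -> nat) (b : nat -> R) (N : R) : K :=
  mracah n (xvar N) (fun k => cst (b k)).

Definition mu (n : 'I_p -> nat) (b : nat -> R) (j : nat) : R :=
  - (psum n j)%:R * ((psum n j)%:R - 1 + b j.+1 - b 0%N).

End RationalFunctions.

(* Main.v *)
Require Import Defs.
From HB Require Import structures.
From mathcomp Require Import all_boot all_order all_algebra reals.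
From mathcomp Require Import generic_quotient ring.

Set Implicit Arguments.
Unset Strict Implicit.
Unset Printing Implicit Defensive.

Import GRing.Theory Num.Theory.
Local Open Scope ring_scope.

(** The operator L_q(x_1, ..., x_q; b_0, ..., b_q, c; M) depends on M and c only
    through the last factor of its coefficients, (t + c + M)(M - t), where t is
    the last (possibly reflected) variable that is shifted. Hence
      L_q(M, c) = M (M + c) X_0 - c X_1 - X_2,
    where the moment operator X_k carries t ^ k in place of that factor, and
    involves neither M nor c. Singling out the last variable z = x_(q+1), with
    b = b_(q+1) and E the shift of z, gives the recursion
      X_k^(q+1) = X_k + w(z) z^k W(z+b) (E - 1)
                      + w(-z-b) (-z-b)^k W(-z) (E^-1 - 1),
    where W(y), the ladder operator, is again a combination of X_0, X_1, X_2 and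
    the identity: the factor which joins two consecutive positions is the
    quadratic (y + t)(y + t + 1) in t.

    Everything rests on two relations ([racah_triple]),
      L(M,c) W(M+c) = W(M+c) L(M+1,c),
      W(M+c) W(-M-1) = (L(M,c) + A) (L(M,c) + B)   for explicit scalars A, B,
    which pass from q to q + 1 ([extend_racah_triple]). Put U = W(z+b) E,
    V = W(-z) E^-1 and L = L(z,b). By the relations L commutes with U and V, and
    UV and VU are polynomials in L. Quadratic interpolation at the two points z
    and -z-b shows that every combination of the new moments has the form
    alpha U + kappa V + delta L + epsilon with coefficients rational in z
    ([extend_normal_form]), so that the new relations are nine identities
    between rational functions, one for each of the words UU, VV, UL, ..., 1.

    Commutation: L_i commutes with U, V and itself, hence with the moments of
    level i + 1, and then with those of all higher levels, out of which L_j is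
    built for j > i ([level_casimir_commute]).

    Eigenfunctions: let Phi(M) be the product of the first q Racah factors. One
    shows together that L(M,c) Phi(M) = mu Phi(M) and that W(M+c) Phi(M+1) is an
    explicit scalar times Phi(M) ([racah_product_eigen]). As U and V then act on
    Phi by scalars, a new moment operator acts on Phi g, with g a function of z,
    as Phi times a second order difference operator in z applied to g. In the
    basis (s-z)_k (s+b+z)_k this operator is bidiagonal ([racah_op_basis]), and
    comparing coefficients of the 4F3 series gives the eigenvalue equation
    ([racah_factor_casimir]) and the contiguity relation in M
    ([racah_factor_ladder]).

    Finally, shifts and reflections are automorphisms of the field of rational
    functions, which turns the explicit sum over {-1,0,1}^q into the recursion
    above ([Lx_casimir]); and linear combinations of shifts are closed under
    composition, which gives the algebra ([gen_comm_subalgebra]). *)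

(** * Subfields as predicates *)

Section Subfield.
Variable F : fieldType.

Definition subfield (C : F -> Prop) : Prop :=
  [/\ C 1, forall u v, C u -> C v -> C (u - v),
      forall u v, C u -> C v -> C (u * v) & forall u, C u -> C u^-1].

Variable C : F -> Prop.
Hypothesis CF : subfield C.

Lemma subfield1 : C 1.
Proof. by case: CF. Qed.

Lemma subfieldB u v : C u -> C v -> C (u - v).
Proof. by case: CF => _ h _ _; apply: h. Qed.

Lemma subfield0 : C 0.
Proof. rewrite -(subrr 1); exact: subfieldB subfield1 subfield1. Qed.

Lemma subfieldN u : C u -> C (- u).
Proof. by move=> cu; rewrite -sub0r; exact: subfieldB subfield0 cu. Qed.

Lemma subfieldD u v : C u -> C v -> C (u + v).
Proof. by move=> cu cv; rewrite -(opprK v); apply/subfieldB/subfieldN. Qed.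

Lemma subfieldM u v : C u -> C v -> C (u * v).
Proof. by case: CF => _ _ h _; apply: h. Qed.

Lemma subfieldV u : C u -> C u^-1.
Proof. by case: CF => _ _ _; apply. Qed.

Lemma subfieldX u k : C u -> C (u ^+ k).
Proof.
move=> cu; elim: k => [|k IH]; first exact: subfield1.
by rewrite exprS; exact: subfieldM.
Qed.

Lemma subfield_nat k : C k%:R.
Proof.
elim: k => [|k IH]; first exact: subfield0.
by rewrite mulrS; apply: subfieldD => //; exact: subfield1.
Qed.
End Subfield.

Ltac in_subfield :=
  match goal with CF : subfield ?C |- ?C _ =>
    repeat first [ assumption | apply: (subfieldB CF) | apply: (subfieldN CF)
      | apply: (subfieldD CF) | apply: (subfieldM CF) | apply: (subfieldV CF)
      | apply: (subfieldX CF) | apply: (subfield_nat CF) | apply: (subfield1 CF)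
      | apply: (subfield0 CF) ]
  end.

(** * Operators generated by a ladder pair *)

Section FourTerm.
Variables (F : fieldType) (U V L : F -> F).

Definition four_term (a k d e f : F) : F := a * U f + k * V f + d * L f + e * f.

(** The coefficient c turns into cp when moved across U, into cm across V, and
    is unchanged across L: in the application, its values at z + 1 and z - 1. *)
Definition passes (c cp cm : F) : Prop :=
  [/\ forall f, U (c * f) = cp * U f, forall f, V (c * f) = cm * V f
    & forall f, L (c * f) = c * L f].

Hypothesis UD : forall f g, U (f + g) = U f + U g.
Hypothesis VD : forall f g, V (f + g) = V f + V g.
Hypothesis LD : forall f g, L (f + g) = L f + L g.

Lemma passesD c cp cm d dp dm :
  passes c cp cm -> passes d dp dm -> passes (c + d) (cp + dp) (cm + dm).
Proof.
case=> Uc Vc Lc [Ud Vd Ld]; split=> f; rewrite mulrDl.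
- by rewrite UD Uc Ud mulrDl.
- by rewrite VD Vc Vd mulrDl.
- by rewrite LD Lc Ld mulrDl.
Qed.

Variables A B A' B' : F.
Hypothesis LU : forall f, L (U f) = U (L f).
Hypothesis LV : forall f, L (V f) = V (L f).
Hypothesis UV : forall f, U (V f) = L (L f) + (A + B) * L f + A * B * f.
Hypothesis VU : forall f, V (U f) = L (L f) + (A' + B') * L f + A' * B' * f.

(** The words on the right-hand side form a basis of the products of two
    four-term operators, as in a generalized Weyl algebra over the polynomials
    in L: identities between such products are checked coefficientwise. *)
Lemma four_term_comp (a1 k1 d1 e1 a2 k2 d2 e2 : F)
    (a2p k2p d2p e2p a2m k2m d2m e2m : F) (f : F) :
  passes a2 a2p a2m -> passes k2 k2p k2m -> passes d2 d2p d2m ->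
  passes e2 e2p e2m ->
  four_term a1 k1 d1 e1 (four_term a2 k2 d2 e2 f) =
    (a1 * a2p) * U (U f) + (k1 * k2m) * V (V f)
    + (a1 * d2p + d1 * a2) * U (L f) + (a1 * e2p + e1 * a2) * U f
    + (k1 * d2m + d1 * k2) * V (L f) + (k1 * e2m + e1 * k2) * V f
    + (a1 * k2p + k1 * a2m + d1 * d2) * L (L f)
    + (a1 * k2p * (A + B) + k1 * a2m * (A' + B') + d1 * e2 + e1 * d2) * L f
    + (a1 * k2p * (A * B) + k1 * a2m * (A' * B') + e1 * e2) * f.
Proof.
case=> Ua Va La [Uk Vk Lk] [Ud Vd Ld] [Ue Ve Le].
rewrite /four_term !UD !VD !LD Ua Uk Ud Ue Va Vk Vd Ve La Lk Ld Le.
by rewrite UV VU !LU !LV; ring.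
Qed.
End FourTerm.

(** * Moment operators: the step from q to q + 1 variables *)

Section Moments.
Variable F : fieldType.
Implicit Types (X : nat -> F -> F) (z b M c y f : F).

(** With X_k the k-th moment operator in q variables, this is the operator
    L_q(x_1, ..., x_q; b_0, ..., b_q, c; M), because
    (t + c + M) (M - t) = M (M + c) - c t - t ^ 2. *)
Definition casimir X M c f := M * (M + c) * X 0%N f - c * X 1%N f - X 2%N f.

(** The first three terms are the moment of (y + t) (y + t + 1); the last one
    is the first factor of the coefficients, for the sequences of positions
    that begin at the new variable. *)
Definition ladder X b0 y f :=
  y * (y + 1) * X 0%N f + (2%:R * y + 1) * X 1%N f + X 2%N f
  + y * (y - b0) * f.

Definition weight b t : F := ((2%:R * t + b) * (2%:R * t + b + 1))^-1.

Definition extend X b0 (E E' : F -> F) z b (k : nat) f :=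
  X k f + weight b z * z ^+ k * ladder X b0 (z + b) (E f - f)
  + weight b (- z - b) * (- z - b) ^+ k * ladder X b0 (- z) (E' f - f).

(** C is the field of constants of the operators X_k, that is, the functions
    that do not involve x_1, ..., x_q. *)
Record racah_triple (C : F -> Prop) b0 X : Prop := RacahTriple {
  momentD : forall k f g, X k (f + g) = X k f + X k g;
  momentZ : forall k c f, C c -> X k (c * f) = c * X k f;
  casimir_ladder : forall M c f, C M -> C c ->
    casimir X M c (ladder X b0 (M + c) f)
    = ladder X b0 (M + c) (casimir X (M + 1) c f);
  ladder_ladder : forall M c f, C M -> C c ->
    let A := (M + c) * (M + 1 + b0) in let B := (M + c - b0) * (M + 1) in
    ladder X b0 (M + c) (ladder X b0 (- M - 1) f)
    = casimir X M c (casimir X M c f) + (A + B) * casimir X M c f + A * B * f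
}.

Lemma racah_triple_sub (C C' : F -> Prop) b0 X : (forall u, C' u -> C u) ->
  racah_triple C b0 X -> racah_triple C' b0 X.
Proof.
move=> sub [h1 h2 h3 h4]; split=> *;
  by [exact: h1 | apply: h2; auto | apply: h3; auto | apply: h4; auto].
Qed.

Section Linear.
Variables (C : F -> Prop) (b0 : F) (X : nat -> F -> F).
Hypothesis (CF : subfield C) (RX : racah_triple C b0 X).
Let XD := momentD RX.
Let XZ := momentZ RX.

Lemma momentN k f : X k (- f) = - X k f.
Proof. by rewrite -mulN1r XZ ?mulN1r //; in_subfield. Qed.

Lemma ladderD y f g : ladder X b0 y (f + g) = ladder X b0 y f + ladder X b0 y g.
Proof. by rewrite /ladder !XD; ring. Qed.

Lemma ladderB y f g : ladder X b0 y (f - g) = ladder X b0 y f - ladder X b0 y g.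
Proof. by rewrite /ladder !XD !momentN; ring. Qed.

Lemma ladderZ y c f : C c -> ladder X b0 y (c * f) = c * ladder X b0 y f.
Proof. by move=> Cc; rewrite /ladder !XZ //; ring. Qed.

Lemma casimirD M c f g :
  casimir X M c (f + g) = casimir X M c f + casimir X M c g.
Proof. by rewrite /casimir !XD; ring. Qed.

Lemma casimirZ M c u f : C u -> casimir X M c (u * f) = u * casimir X M c f.
Proof. by move=> Cu; rewrite /casimir !XZ //; ring. Qed.
End Linear.

Lemma casimir_refl X M c f : casimir X (- M - c) c f = casimir X M c f.
Proof. by rewrite /casimir; ring. Qed.

Lemma ladder_morph X (s : {rmorphism F -> F}) (b0 : F) y f :
  (forall k f, s (X k f) = X k (s f)) -> s b0 = b0 ->
  s (ladder X b0 y f) = ladder X b0 (s y) (s f).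
Proof.
move=> sX sb0; rewrite /ladder.
by rewrite !(rmorphD, rmorphM, rmorphN, rmorph_nat, rmorph1) /= !sX sb0.
Qed.

Lemma casimir_morph X (s : {rmorphism F -> F}) M c f :
  (forall k f, s (X k f) = X k (s f)) ->
  s (casimir X M c f) = casimir X (s M) (s c) (s f).
Proof.
by move=> sX; rewrite /casimir !(rmorphB, rmorphD, rmorphM) /= !sX.
Qed.

(** The coefficients in [extend_normal_form] of the combination of moments
    with the quadratic e0 + e1 t + e2 t ^ 2 as last factor. *)
Definition quad (e0 e1 e2 t : F) := e0 + e1 * t + e2 * t ^+ 2.
Definition up_coef b e0 e1 e2 z := weight b z * quad e0 e1 e2 z.
Definition down_coef b e0 e1 e2 z := up_coef b e0 e1 e2 (- z - b).
Definition cas_coef b e0 e1 e2 z :=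
  up_coef b e0 e1 e2 z + down_coef b e0 e1 e2 z - e2.
Definition const_coef b b0 e0 e1 e2 z :=
  - (up_coef b e0 e1 e2 z * ((z + b) * (z + b - b0))
     + down_coef b e0 e1 e2 z * (- z * (- z - b0))).

Section CoefMorph.
Variables (s : {rmorphism F -> F}) (b b0 e0 e1 e2 : F).
Hypothesis (sb : s b = b) (sb0 : s b0 = b0).
Hypothesis (s0 : s e0 = e0) (s1 : s e1 = e1) (s2 : s e2 = e2).

Lemma up_coef_morph t : s (up_coef b e0 e1 e2 t) = up_coef b e0 e1 e2 (s t).
Proof.
rewrite /up_coef /weight /quad.
rewrite !(rmorphD, rmorphM, fmorphV, rmorph_nat, rmorph1, rmorphXn) /=.
by rewrite sb s0 s1 s2.
Qed.

Lemma down_coef_morph t :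
  s (down_coef b e0 e1 e2 t) = down_coef b e0 e1 e2 (s t).
Proof. by rewrite /down_coef up_coef_morph rmorphB rmorphN sb. Qed.

Lemma cas_coef_morph t : s (cas_coef b e0 e1 e2 t) = cas_coef b e0 e1 e2 (s t).
Proof.
by rewrite /cas_coef rmorphB rmorphD up_coef_morph down_coef_morph s2.
Qed.

Lemma const_coef_morph t :
  s (const_coef b b0 e0 e1 e2 t) = const_coef b b0 e0 e1 e2 (s t).
Proof.
rewrite /const_coef rmorphN rmorphD.
rewrite [s (up_coef _ _ _ _ _ * _)]rmorphM [s (down_coef _ _ _ _ _ * _)]rmorphM.
rewrite up_coef_morph down_coef_morph !(rmorphD, rmorphM, rmorphN) /=.
by rewrite sb sb0.
Qed.
End CoefMorph.

Section Step.
Variables (C : F -> Prop) (b0 z b : F) (X : nat -> F -> F).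
Variables (E E' : {rmorphism F -> F}).

Record level_step : Prop := LevelStep {
  step_closed : subfield C;
  step_triple : racah_triple C b0 X;
  step_C : [/\ C b0, C z & C b];
  step_K : cancel E E' /\ cancel E' E;
  step_stable : forall u, C u -> C (E u) /\ C (E' u);
  step_moment : forall k f, E (X k f) = X k (E f) /\ E' (X k f) = X k (E' f);
  step_values : [/\ E z = z + 1, E b = b & E b0 = b0];
  step_neq0 : forall n : int, 2%:R * z + b + n%:~R != 0
}.
Hypothesis D : level_step.

Let CF : subfield C. Proof. exact: step_closed D. Qed.
Let RX : racah_triple C b0 X. Proof. exact: step_triple D. Qed.
Let Cb0 : C b0. Proof. by case: (step_C D). Qed.
Let Cz : C z. Proof. by case: (step_C D). Qed.
Let Cb : C b. Proof. by case: (step_C D). Qed.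
Let EK : cancel E E'. Proof. by case: (step_K D). Qed.
Let E'K : cancel E' E. Proof. by case: (step_K D). Qed.
Let CE u (Cu : C u) : C (E u). Proof. by case: (step_stable D Cu). Qed.
Let CE' u (Cu : C u) : C (E' u). Proof. by case: (step_stable D Cu). Qed.
Let XE k f : E (X k f) = X k (E f). Proof. by case: (step_moment D k f). Qed.
Let XE' k f : E' (X k f) = X k (E' f). Proof. by case: (step_moment D k f). Qed.
Let Ez : E z = z + 1. Proof. by case: (step_values D). Qed.
Let Eb : E b = b. Proof. by case: (step_values D). Qed.
Let Eb0 : E b0 = b0. Proof. by case: (step_values D). Qed.
Let nz := step_neq0 D.

Let E'fix u : E u = u -> E' u = u.
Proof. by move=> Eu; rewrite -[RHS]EK Eu. Qed.

Let E'z : E' z = z - 1.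
Proof. by rewrite -[RHS](EK) rmorphB rmorph1 Ez addrK. Qed.

Definition raise_op f := ladder X b0 (z + b) (E f).
Definition lower_op f := ladder X b0 (- z) (E' f).
Definition level_op f := casimir X z b f.

Lemma raise_opD f g : raise_op (f + g) = raise_op f + raise_op g.
Proof. by rewrite /raise_op rmorphD (ladderD RX). Qed.

Lemma lower_opD f g : lower_op (f + g) = lower_op f + lower_op g.
Proof. by rewrite /lower_op rmorphD (ladderD RX). Qed.

Lemma level_opD f g : level_op (f + g) = level_op f + level_op g.
Proof. exact: casimirD RX _ _ _ _. Qed.

Lemma level_raise f : level_op (raise_op f) = raise_op (level_op f).
Proof.
rewrite /level_op /raise_op (casimir_ladder RX) // casimir_morph //.
by rewrite Ez Eb.
Qed.

(** The relation used for [level_raise], at the point - z - b instead of z: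
    the operator level_op is invariant under z |-> - z - b. *)
Lemma level_lower f : level_op (lower_op f) = lower_op (level_op f).
Proof.
have h g : lower_op g = ladder X b0 (- z - b + b) (E' g) by rewrite subrK.
rewrite !h /level_op -casimir_refl (casimir_ladder RX) //; try in_subfield.
rewrite casimir_morph // E'z (E'fix Eb) -casimir_refl.
by congr (ladder X b0 _ (casimir X _ _ _)); ring.
Qed.

Lemma raise_lower f :
  let A := (z + b) * (z + 1 + b0) in let B := (z + b - b0) * (z + 1) in
  raise_op (lower_op f)
  = level_op (level_op f) + (A + B) * level_op f + A * B * f.
Proof.
move=> A B; rewrite /raise_op /lower_op ladder_morph // rmorphN Ez E'K opprD.
exact: (ladder_ladder RX).
Qed.

Lemma lower_raise f :
  let A := - z * (- z - b + 1 + b0) in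
  let B := (- z - b0) * (- z - b + 1) in
  lower_op (raise_op f)
  = level_op (level_op f) + (A + B) * level_op f + A * B * f.
Proof.
move=> A B; rewrite /raise_op /lower_op ladder_morph ?(E'fix Eb0) //.
rewrite rmorphD E'z (E'fix Eb) EK.
have -> : z - 1 + b = - (- z - b) - 1 by ring.
have -> g : ladder X b0 (- z) g = ladder X b0 (- z - b + b) g by rewrite subrK.
rewrite (ladder_ladder RX) //; try in_subfield.
by rewrite !casimir_refl !subrK.
Qed.

Let w := 2%:R * z + b.

Let weightsE : (weight b z = (w * (w + 1))^-1) *
  (weight b (- z - b) = (w * (w - 1))^-1) *
  (weight b (z + 1) = ((w + 2%:R) * (w + 3%:R))^-1) *
  (weight b (- (z + 1) - b) = ((w + 2%:R) * (w + 1))^-1) *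
  (weight b (z - 1) = ((w - 2%:R) * (w - 1))^-1) *
  (weight b (- (z - 1) - b) = ((w - 2%:R) * (w - 3%:R))^-1).
Proof. by rewrite /weight /w; do !split; congr (_^-1); ring. Qed.

Let weights_neq0 : [/\ w != 0, w + 1 != 0, w - 1 != 0 &
  [/\ w + 2%:R != 0, w + 3%:R != 0, w - 2%:R != 0 & w - 3%:R != 0]].
Proof.
have h (n : int) (e : F) : e = w + n%:~R -> e != 0 by move=> ->; exact: nz.
split; last split; [apply: (h 0)|apply: (h 1)|apply: (h (-1))|apply: (h 2)
 |apply: (h 3)|apply: (h (-2))|apply: (h (-3))]; ring.
Qed.

Ltac compare_coefs :=
  rewrite /const_coef /cas_coef /down_coef /up_coef /=;
  rewrite !weightsE /quad /w;
  case: weights_neq0 => ? ? ? [? ? ? ?];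
  field; repeat (apply/andP; split); assumption.

Let Y := extend X b0 E E' z b.

Definition normal_form e0 e1 e2 u f :=
  four_term raise_op lower_op level_op
    (up_coef b e0 e1 e2 z) (down_coef b e0 e1 e2 z)
    (cas_coef b e0 e1 e2 z) (const_coef b b0 e0 e1 e2 z + u) f.

(** Terms without shift: with e(t) = e0 + e1 t + e2 t ^ 2, the polynomial
      e(t) - w(z) e(z) (z+b+t) (z+b+t+1) - w(-z-b) e(-z-b) (t-z) (t-z+1)
    vanishes at t = z and at t = - z - b, hence is a multiple of
    (t + z + b) (z - t), the last factor of level_op. *)
Lemma extend_normal_form e0 e1 e2 u f :
  e0 * Y 0%N f + e1 * Y 1%N f + e2 * Y 2%N f + u * f
  = normal_form e0 e1 e2 u f.
Proof.
rewrite /Y /extend !(ladderB CF RX).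
rewrite /normal_form /four_term /raise_op /lower_op /level_op.
set UU := ladder X b0 (z + b) (E f); set VV := ladder X b0 (- z) (E' f).
rewrite /ladder /casimir; compare_coefs.
Qed.

Lemma casimir_extend M c f :
  casimir Y M c f = normal_form (M * (M + c)) (- c) (-1) 0 f.
Proof. by rewrite -extend_normal_form /casimir; ring. Qed.

Lemma ladder_extend y f :
  ladder Y b0 y f
  = normal_form (y * (y + 1)) (2%:R * y + 1) 1 (y * (y - b0)) f.
Proof. by rewrite -extend_normal_form /ladder; ring. Qed.

Lemma passesP u : C u -> passes raise_op lower_op level_op u (E u) (E' u).
Proof.
move=> Cu; split=> f.
- by rewrite /raise_op rmorphM (ladderZ RX) //; exact: CE.
- by rewrite /lower_op rmorphM (ladderZ RX) //; exact: CE'.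
- exact: casimirZ RX _ _ _ _ Cu.
Qed.

Let transported (g : F -> F) :=
  passes raise_op lower_op level_op (g z) (g (z + 1)) (g (z - 1)).

Lemma coefs_transported e0 e1 e2 u : C e0 -> C e1 -> C e2 -> C u ->
  E e0 = e0 -> E e1 = e1 -> E e2 = e2 -> E u = u ->
  [/\ transported (up_coef b e0 e1 e2), transported (down_coef b e0 e1 e2),
      transported (cas_coef b e0 e1 e2)
    & transported (fun t => const_coef b b0 e0 e1 e2 t + u)].
Proof.
move=> C0 C1 C2 Cu E0 E1 E2 Eu.
have [E'0 E'1 E'2 E'u] := And4 (E'fix E0) (E'fix E1) (E'fix E2) (E'fix Eu).
have [E'b E'b0] := conj (E'fix Eb) (E'fix Eb0).
split; rewrite /transported -Ez -E'z.
- rewrite -(up_coef_morph (s := E)) // -(up_coef_morph (s := E')) //.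
  by apply: passesP; rewrite /up_coef /weight /quad; in_subfield.
- rewrite -(down_coef_morph (s := E)) // -(down_coef_morph (s := E')) //.
  by apply: passesP; rewrite /down_coef /up_coef /weight /quad; in_subfield.
- rewrite -(cas_coef_morph (s := E)) // -(cas_coef_morph (s := E')) //.
  apply: passesP; rewrite /cas_coef /down_coef /up_coef /weight /quad.
  by in_subfield.
- rewrite -(const_coef_morph (s := E)) // -(const_coef_morph (s := E')) //.
  apply: (passesD raise_opD lower_opD level_opD).
    apply: passesP; rewrite /const_coef /down_coef /up_coef /weight /quad.
    by in_subfield.
  by have := passesP Cu; rewrite Eu E'u.
Qed.

Lemma casimir_transported M c : C M -> C c -> E M = M -> E c = c ->
  let e0 := M * (M + c) in
  [/\ transported (up_coef b e0 (- c) (-1)),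
      transported (down_coef b e0 (- c) (-1)),
      transported (cas_coef b e0 (- c) (-1))
    & transported (fun t => const_coef b b0 e0 (- c) (-1) t + 0)].
Proof.
move=> CM Cc EM Ec e0; apply: coefs_transported; try in_subfield;
  by rewrite !(rmorphM, rmorphD, rmorphN, rmorph1, rmorph0) /= ?EM ?Ec.
Qed.

Lemma ladder_transported y : C y -> E y = y ->
  let e0 := y * (y + 1) in let e1 := 2%:R * y + 1 in
  [/\ transported (up_coef b e0 e1 1), transported (down_coef b e0 e1 1),
      transported (cas_coef b e0 e1 1)
    & transported (fun t => const_coef b b0 e0 e1 1 t + y * (y - b0))].
Proof.
move=> Cy Ey e0 e1; apply: coefs_transported; try in_subfield;
  by rewrite !(rmorphM, rmorphD, rmorphN, rmorph1, rmorph_nat) /= ?Ey ?Eb0.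
Qed.

Let comp_rule := four_term_comp
  (A := (z + b) * (z + 1 + b0)) (B := (z + b - b0) * (z + 1))
  (A' := - z * (- z - b + 1 + b0)) (B' := (- z - b0) * (- z - b + 1))
  raise_opD lower_opD level_opD level_raise level_lower raise_lower lower_raise.

Lemma extend_casimir_ladder M c f : C M -> C c -> E M = M -> E c = c ->
  casimir Y M c (ladder Y b0 (M + c) f)
  = ladder Y b0 (M + c) (casimir Y (M + 1) c f).
Proof.
move=> CM Cc EM Ec.
have Cy : C (M + c) by in_subfield.
have Ey : E (M + c) = M + c by rewrite rmorphD EM Ec.
have CM1 : C (M + 1) by in_subfield.
have EM1 : E (M + 1) = M + 1 by rewrite rmorphD rmorph1 EM.
have [a2 k2 d2 g2] := ladder_transported Cy Ey.
have [a1 k1 d1 g1] := casimir_transported CM1 Cc EM1 Ec.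
rewrite !casimir_extend !ladder_extend /normal_form.
rewrite (comp_rule _ _ _ _ _ a2 k2 d2 g2) (comp_rule _ _ _ _ _ a1 k1 d1 g1).
(* naming the words makes the field tactic treat them as atoms *)
set UU := raise_op (raise_op f); set VV := lower_op (lower_op f).
set UL := raise_op (level_op f); set VL := lower_op (level_op f).
set LL := level_op (level_op f); set U := raise_op f.
set V := lower_op f; set L := level_op f.
compare_coefs.
Qed.

Lemma extend_ladder_ladder M c f : C M -> C c -> E M = M -> E c = c ->
  let A := (M + c) * (M + 1 + b0) in let B := (M + c - b0) * (M + 1) in
  ladder Y b0 (M + c) (ladder Y b0 (- M - 1) f)
  = casimir Y M c (casimir Y M c f) + (A + B) * casimir Y M c f + A * B * f.
Proof.
move=> CM Cc EM Ec A B.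
have CM1 : C (- M - 1) by in_subfield.
have EM1 : E (- M - 1) = - M - 1 by rewrite rmorphB rmorphN rmorph1 EM.
have [a2 k2 d2 g2] := ladder_transported CM1 EM1.
have [a1 k1 d1 g1] := casimir_transported CM Cc EM Ec.
rewrite !casimir_extend !ladder_extend /normal_form.
rewrite (comp_rule _ _ _ _ _ a2 k2 d2 g2) (comp_rule _ _ _ _ _ a1 k1 d1 g1).
rewrite /four_term.
set UU := raise_op (raise_op f); set VV := lower_op (lower_op f).
set UL := raise_op (level_op f); set VL := lower_op (level_op f).
set LL := level_op (level_op f); set U := raise_op f.
set V := lower_op f; set L := level_op f.
rewrite /A /B; compare_coefs.
Qed.

Lemma extend_racah_triple :
  racah_triple (fun u => [/\ C u, E u = u & E' u = u]) b0 Y.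
Proof.
split.
- move=> k f g; rewrite /Y /extend (momentD RX) !rmorphD /=.
  by rewrite !(ladderB CF RX) !(ladderD RX); ring.
- move=> k u f [Cu Eu Eu']; rewrite /Y /extend !(momentZ RX) // !rmorphM /=.
  by rewrite Eu Eu' !(ladderB CF RX) !(ladderZ RX) //; ring.
- move=> M c f [CM EM EM'] [Cc Ec Ec']; exact: extend_casimir_ladder.
- move=> M c f [CM EM EM'] [Cc Ec Ec']; exact: extend_ladder_ladder.
Qed.

(** All four operators of the normal form commute with level_op, and so do its
    coefficients. The moments that occur are those of order at most 2. *)
Lemma level_op_extend k f : (k < 3)%N -> level_op (Y k f) = Y k (level_op f).
Proof.
have key e0 e1 e2 : C e0 -> C e1 -> C e2 ->
    level_op (e0 * Y 0%N f + e1 * Y 1%N f + e2 * Y 2%N f + 0 * f)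
    = e0 * Y 0%N (level_op f) + e1 * Y 1%N (level_op f)
      + e2 * Y 2%N (level_op f) + 0 * level_op f.
  move=> C0 C1 C2; rewrite !extend_normal_form /normal_form /four_term.
  rewrite (level_opD (_ + _ + _)) (level_opD (_ + _)) level_opD.
  rewrite -level_raise -level_lower /level_op !(casimirZ RX) //;
    rewrite /const_coef /cas_coef /down_coef /up_coef /quad /weight;
    in_subfield.
have C0 := subfield0 CF; have C1 := subfield1 CF.
case: k => [|[|[|//]]] _.
- by have := key 1 0 0 C1 C0 C0; rewrite !mul1r !mul0r !addr0.
- by have := key 0 1 0 C0 C1 C0; rewrite !mul1r !mul0r !addr0 !add0r.
- by have := key 0 0 1 C0 C0 C1; rewrite !mul1r !mul0r !addr0 !add0r.
Qed.
End Step.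
End Moments.

(** * One-variable Racah polynomials *)

Section Rising.
Variable F : fieldType.
Implicit Types (a b c d x : F).

Lemma rising0 a : rising a 0 = 1.
Proof. exact: big_ord0. Qed.

Lemma risingSr a k : rising a k.+1 = rising a k * (a + k%:R).
Proof. exact: big_ord_recr. Qed.

Lemma risingSl a k : rising a k.+1 = a * rising (a + 1) k.
Proof.
rewrite /rising big_ord_recl /= addr0; congr (_ * _); apply: eq_bigr => i _.
by rewrite /bump /= natrD addrA.
Qed.

Lemma rising_morph (s : {rmorphism F -> F}) a k : s (rising a k) = rising (s a) k.
Proof.
by rewrite rmorph_prod; apply: eq_bigr => i _; rewrite rmorphD rmorph_nat.
Qed.

Lemma racah_morph (s : {rmorphism F -> F}) n a b c d x :
  s (racah n a b c d x) = racah n (s a) (s b) (s c) (s d) (s x).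
Proof.
rewrite /racah rmorph_sum; apply: eq_bigr => k _.
by do 8![rewrite ?(rmorphM, rmorphD, rmorphN, rmorph1, rmorph_nat, fmorphV,
  rising_morph) /=].
Qed.
End Rising.

Section RacahFactor.
Variable F : fieldType.
Implicit Types (b M c z s : F) (n k : nat).

(** The factor of the multivariable polynomial attached to the variable z, with
    (z, b) and (M, c) standing for (x_k, b_k) and (x_(k+1), b_(k+1)), and s for
    the sum of the preceding degrees. *)
Definition racah_factor n (b0 s b M c z : F) : F :=
  racah n (2%:R * s + b - b0 - 1) (c - b - 1) (s - M - 1) (s + b + M) (- s + z).

Definition racah_basis k (s b z : F) := rising (s - z) k * rising (s + b + z) k.

Definition racah_coef n k (A B D G : F) :=
  rising (- n%:R) k * rising (n%:R + B) k / k`!%:R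
  * rising (A + k%:R) (n - k) * rising (D + k%:R) (n - k)
  * rising (G + k%:R) (n - k).

Lemma racah_factorE n (b0 : F) s b M c z :
  racah_factor n b0 s b M c z =
  \sum_(k < n.+1) racah_coef n k (2%:R * s + b - b0) (2%:R * s + c - b0 - 1)
     (s + c + M) (s - M) * racah_basis k s b z.
Proof.
apply: eq_bigr => k _; rewrite /racah_coef /racah_basis.
have -> : n%:R + (2%:R * s + b - b0 - 1) + (c - b - 1) + 1
  = n%:R + (2%:R * s + c - b0 - 1) by ring.
have -> : - (- s + z) = s - z by ring.
have -> : - s + z + (s - M - 1) + (s + b + M) + 1 = s + b + z by ring.
have -> : 2%:R * s + b - b0 - 1 + 1 + k%:R = 2%:R * s + b - b0 + k%:R by ring.
have -> : c - b - 1 + (s + b + M) + 1 + k%:R = s + c + M + k%:R by ring.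
have -> : s - M - 1 + 1 + k%:R = s - M + k%:R by ring.
ring.
Qed.

Lemma racah_factor_refl n (b0 : F) s b M c z :
  racah_factor n b0 s b (- M - c) c z = racah_factor n b0 s b M c z.
Proof.
rewrite !racah_factorE; apply: eq_bigr => k _; rewrite /racah_coef.
have -> : s + c + (- M - c) = s - M by ring.
have -> : s - (- M - c) = s + c + M by ring.
ring.
Qed.

Lemma racah_factor_morph (t : {rmorphism F -> F}) n (b0 : F) m b M c z :
  t (racah_factor n b0 m%:R b M c z)
  = racah_factor n (t b0) m%:R (t b) (t M) (t c) (t z).
Proof.
rewrite /racah_factor racah_morph.
have -> : t (2%:R * m%:R + b - b0 - 1) = 2%:R * m%:R + t b - t b0 - 1.
  by rewrite !rmorphB rmorphD rmorphM !rmorph_nat rmorph1.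
have -> : t (c - b - 1) = t c - t b - 1 by rewrite !rmorphB rmorph1.
have -> : t (m%:R - M - 1) = m%:R - t M - 1.
  by rewrite !rmorphB rmorph_nat rmorph1.
have -> : t (m%:R + b + M) = m%:R + t b + t M by rewrite !rmorphD rmorph_nat.
by have -> : t (- m%:R + z) = - m%:R + t z by rewrite rmorphD rmorphN rmorph_nat.
Qed.

Lemma racah_coefS n k (A B D G : F) :
  (forall k : nat, k.+1%:R != 0 :> F) -> (k < n)%N ->
  k.+1%:R * racah_coef n k.+1 A B D G * ((A + k%:R) * (D + k%:R) * (G + k%:R))
  = (k%:R - n%:R) * (n%:R + B + k%:R) * racah_coef n k A B D G.
Proof.
move=> ch0 kn; rewrite /racah_coef -(subnSK kn).
rewrite [rising (- _) _]risingSr [rising (_ + B) _]risingSr !risingSl factS natrM.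
have h m : m`!%:R != 0 :> F.
  by elim: m => [|m IH]; rewrite ?oner_eq0 // factS natrM mulf_neq0.
have hS (a : F) : a + k.+1%:R = a + k%:R + 1.
  by rewrite -[in LHS]addn1 natrD addrA.
rewrite !hS.
by field; rewrite h -[1]/1%:R -natrD; apply: ch0.
Qed.

Section Operator.
Variables (b0 s b z e0 e1 e2 : F).
Let w := 2%:R * z + b.
Hypothesis (w0 : w != 0) (w1 : w + 1 != 0) (w2 : w - 1 != 0).

(** The scalar of the ladder relation of [racah_product_eigen], for a product of
    Racah factors of total degree s. *)
Definition ladder_value m := (m + b + s - b0) * (m + b + s).

(** The action of a normal form with coefficients up_coef, down_coef, cas_coef
    and const_coef on the product of the preceding Racah factors times a
    function of z with values g, gp, gm at z, z + 1, z - 1, divided by that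
    product. *)
Definition racah_op (g gp gm : F) : F :=
  up_coef b e0 e1 e2 z * ladder_value z * gp
  + down_coef b e0 e1 e2 z * ladder_value (- z - b) * gm
  + (cas_coef b e0 e1 e2 z * (- s * (s - 1 + b - b0))
     + const_coef b b0 e0 e1 e2 z) * g.

(** The diagonal entry of [racah_op] in degree m - s in z (z + b).
    See [racah_op_basis]. *)
Definition spectrum (m : F) := e1 * m + e2 * (m * (m - 1 - b0)).

Let weightsE2 : (weight b z = (w * (w + 1))^-1) *
  (weight b (- z - b) = (w * (w - 1))^-1).
Proof. by rewrite /weight /w; do !split; congr (_^-1); ring. Qed.

(** Up to the outer factors, racah_basis k at z + 1 and z - 1 differs from its
    value at z by two linear factors, which ladder_value supplies: so the three
    terms have the common factor racah_basis k.-1, and the quotient is a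
    quadratic polynomial in z which is invariant under z |-> - z - b. *)
Lemma racah_op_basis k :
  racah_op (racah_basis k s b z) (racah_basis k s b (z + 1))
    (racah_basis k s b (z - 1))
  = spectrum (s + k%:R) * racah_basis k s b z
    - k%:R * ((2%:R * s + b - b0 + k%:R - 1) * quad e0 e1 e2 (s + k%:R - 1))
      * racah_basis k.-1 s b z.
Proof.
rewrite /racah_op /spectrum /ladder_value /const_coef /cas_coef /down_coef.
rewrite /up_coef !weightsE2 /quad.
case: k => [|k].
  rewrite /racah_basis !rising0 /w; field.
  by rewrite w0 w1 w2.
rewrite /= /racah_basis.
set P := rising (s - z) k; set Q := rising (s + b + z) k.
have e1' : rising (s - (z + 1)) k.+1 = (s - (z + 1)) * P.
  by rewrite risingSl; congr (_ * rising _ _); ring.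
have e2' : (s + b + z) * rising (s + b + (z + 1)) k.+1 =
   Q * (s + b + z + k%:R) * (s + b + z + k%:R + 1).
  rewrite addrA -risingSl !risingSr -/Q; ring.
have e3' : rising (s + b + (z - 1)) k.+1 = (s + b + (z - 1)) * Q.
  by rewrite risingSl; congr (_ * rising _ _); ring.
have e4' : (s - z) * rising (s - (z - 1)) k.+1 =
   P * (s - z + k%:R) * (s - z + k%:R + 1).
  have -> : s - (z - 1) = s - z + 1 by ring.
  rewrite -risingSl !risingSr -/P; ring.
have -> : (z + b + s - b0) * (z + b + s) = (z + b + s - b0) * (s + b + z).
  by ring.
have -> : (- z - b + b + s - b0) * (- z - b + b + s)
  = (s - z - b0) * (s - z) by ring.
rewrite e1' e3' [rising (s - z) _]risingSr [rising (s + b + z) _]risingSr -/P -/Q.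
have r1 (u v X Y Z : F) : u * (v * X) * (Y * Z) = u * v * Y * (X * Z) by ring.
have r2 (u v X Y Z : F) : u * (v * X) * (Z * Y) = u * v * Y * (X * Z) by ring.
rewrite (r1 _ _ (s + b + z)) e2' (r2 _ _ (s - z)) e4' /w -[in RHS]addn1 natrD.
field.
by rewrite w0 w1 w2.
Qed.

Lemma racah_op_series n (C : nat -> F) :
  let tau k := (2%:R * s + b - b0 + k%:R) * quad e0 e1 e2 (s + k%:R) in
  let S x := \sum_(k < n.+1) C k * racah_basis k s b x in
  racah_op (S z) (S (z + 1)) (S (z - 1))
  = \sum_(k < n) (C k * spectrum (s + k%:R) - k.+1%:R * C k.+1 * tau k)
      * racah_basis k s b z
    + C n * spectrum (s + n%:R) * racah_basis n s b z.
Proof.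
move=> tau S.
have -> : racah_op (S z) (S (z + 1)) (S (z - 1)) =
  \sum_(k < n.+1) C k * racah_op (racah_basis k s b z)
     (racah_basis k s b (z + 1)) (racah_basis k s b (z - 1)).
  rewrite /racah_op /S !mulr_sumr -!big_split /=; apply: eq_bigr => k _; ring.
under eq_bigr => k _ do rewrite racah_op_basis mulrBr.
rewrite sumrB big_ord_recr [X in _ - X]big_ord_recl /= !mul0r mulr0 add0r addrAC.
rewrite mulrA; congr (_ + _); rewrite -sumrB; apply: eq_bigr => k _.
rewrite /tau /bump /= add1n.
have hS (u : F) : u + k.+1%:R - 1 = u + k%:R.
  by rewrite -addn1 natrD addrA addrK.
rewrite !hS.
ring.
Qed.
End Operator.

Section Eigen.
Hypothesis char0 : forall k : nat, k.+1%:R != 0 :> F.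
Variables (b0 s b z M c : F) (n : nat).
Let w := 2%:R * z + b.
Hypothesis (w0 : w != 0) (w1 : w + 1 != 0) (w2 : w - 1 != 0).

(** The difference equation of the Racah polynomials. The coefficients of the
    4F3 series satisfy exactly the two-term recursion by which the bidiagonal
    operator of [racah_op_basis] has its series as an eigenvector. *)
Lemma racah_factor_casimir :
  racah_op b0 s b z (M * (M + c)) (- c) (-1) (racah_factor n b0 s b M c z)
    (racah_factor n b0 s b M c (z + 1)) (racah_factor n b0 s b M c (z - 1))
  = - (s + n%:R) * (s + n%:R - 1 + c - b0) * racah_factor n b0 s b M c z.
Proof.
rewrite !racah_factorE.
set C := fun k => racah_coef n k (2%:R * s + b - b0) (2%:R * s + c - b0 - 1)
  (s + c + M) (s - M).
rewrite (racah_op_series _ _ _ _ _ w0 w1 w2 n C) mulr_sumr big_ord_recr /=.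
congr (_ + _); last by rewrite /spectrum /C; ring.
apply: eq_bigr => k _; rewrite [RHS]mulrA; congr (_ * _).
have := racah_coefS (2%:R * s + b - b0) (2%:R * s + c - b0 - 1)
  (s + c + M) (s - M) char0 (ltn_ord k); rewrite -/(C k) -/(C k.+1) => H.
set u := (2%:R * s + b - b0 + k%:R) * _ * _ in H.
rewrite -[_ * quad _ _ _ _]opprK.
have -> : - ((2%:R * s + b - b0 + k%:R)
    * quad (M * (M + c)) (- c) (-1) (s + k%:R)) = u.
  by rewrite /u /quad; ring.
rewrite mulrN H /spectrum; ring.
Qed.

(** The contiguity relation that lowers M + 1 to M: with the quadratic
    (M + c + t)(M + c + t + 1) in place of (M - t)(M + c + t), the same
    bidiagonal operator intertwines the two series. *)
Lemma racah_factor_ladder :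
  racah_op b0 s b z ((M + c) * (M + c + 1)) (2%:R * (M + c) + 1) 1
    (racah_factor n b0 s b (M + 1) c z)
    (racah_factor n b0 s b (M + 1) c (z + 1))
    (racah_factor n b0 s b (M + 1) c (z - 1))
  + (M + c) * (M + c - b0) * racah_factor n b0 s b (M + 1) c z
  = ladder_value b0 (s + n%:R) c M * racah_factor n b0 s b M c z.
Proof.
rewrite !racah_factorE.
set C := fun k => racah_coef n k (2%:R * s + b - b0) (2%:R * s + c - b0 - 1)
  (s + c + (M + 1)) (s - (M + 1)).
rewrite (racah_op_series _ _ _ _ _ w0 w1 w2 n C) !mulr_sumr.
rewrite [X in _ + X = _]big_ord_recr [RHS]big_ord_recr /= addrACA -big_split /=.
congr (_ + _); last first.
  rewrite /spectrum /ladder_value /C /racah_coef subnn !rising0; ring.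
apply: eq_bigr => k _; rewrite ![_ * (_ * racah_basis _ _ _ _)]mulrA -mulrDl.
congr (_ * _).
rewrite /C /racah_coef -(subnSK (ltn_ord k)) [rising (- _) k.+1]risingSr.
rewrite [rising (_ + _) k.+1]risingSr factS natrM.
set m := (n - k.+1)%N.
have nE : n%:R = k%:R + m%:R + 1 :> F.
  by rewrite -[n in LHS](subnKC (ltn_ord k)) -/m addSn -addn1 !natrD.
have hS (a : F) : a + k.+1%:R = a + k%:R + 1.
  by rewrite -[in LHS]addn1 natrD addrA.
rewrite !hS [rising (2%:R * s + b - b0 + k%:R) m.+1]risingSl.
have -> : s + c + (M + 1) + k%:R = s + c + M + k%:R + 1 by ring.
have -> : s - (M + 1) + k%:R + 1 = s - M + k%:R by ring.
rewrite [rising (s - (M + 1) + k%:R) _]risingSl.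
have -> : s - (M + 1) + k%:R + 1 = s - M + k%:R by ring.
rewrite [rising (s - M + k%:R) _.+1]risingSr.
rewrite [rising (s + c + M + k%:R) _]risingSl.
set P := rising (s + c + M + k%:R + 1) m.
have -> : rising (s + c + M + k%:R + 1) m.+1
  = P * (s + c + M + k%:R + 1 + m%:R) by exact: risingSr.
have PE : (s + c + M + k%:R + 1) * rising (s + c + M + k%:R + 1 + 1) m
    = P * (s + c + M + k%:R + 1 + m%:R).
  by rewrite -risingSl -risingSr.
rewrite /quad /spectrum /ladder_value nE.
set R1 := rising (_ + _) k; set R2 := rising (_ + 1 + 1) m in PE *.
set R3 := rising (s - M + k%:R) m.
set R4 := rising (2%:R * _ + _ - _ + _ + 1) m.
set R5 := rising (- _) k; have kf : k`!%:R != 0 :> F.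
  by elim: (nat_of_ord k) => [|i IH]; rewrite ?oner_eq0 // factS natrM mulf_neq0.
(* eliminating M in favour of d makes the left-hand side of PE a monomial, as
   the field tactic requires of the equations that it rewrites with *)
pose d := s + c + M + k%:R + 1.
have ME : M = d - 1 - k%:R - s - c by rewrite /d; ring.
have PE' : d * R2 = P * (d + m%:R) by exact: PE.
clearbody R1 R2 R3 R4 R5 P d; clear PE; rewrite {}ME.
field: PE'; rewrite kf -[1]/1%:R -natrD; exact: char0.
Qed.
End Eigen.
End RacahFactor.

(** * The tower of moment operators *)

Section Tower.
Variables (F : fieldType) (p : nat) (x b : nat -> F).
Variables (E E' : nat -> {rmorphism F -> F}).

(** The positions are 1, ..., p: the variable x_(p+1) and the parameters are
    constants for all shifts. *)
Record shift_system : Prop := ShiftSystem {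
  shiftK : forall k, (0 < k <= p)%N -> cancel (E k) (E' k);
  shiftVK : forall k, (0 < k <= p)%N -> cancel (E' k) (E k);
  shiftC : forall k l, (0 < k <= p)%N -> (0 < l <= p)%N ->
    forall f, E k (E l f) = E l (E k f);
  shift_x : forall k l, (0 < k <= p)%N -> (0 < l)%N ->
    E k (x l) = x l + (k == l)%:R;
  shift_b : forall k l, (0 < k <= p)%N -> E k (b l) = b l;
  shift_char0 : forall k : nat, k.+1%:R != 0 :> F
}.

Hypothesis H : shift_system.

Fixpoint moment q : nat -> F -> F :=
  if q is q'.+1 then
    extend (moment q') (b 0%N) (E q) (E' q) (x q) (b q)
  else fun _ _ => 0.

Lemma momentS q : moment q.+1
  = extend (moment q) (b 0%N) (E q.+1) (E' q.+1) (x q.+1) (b q.+1).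
Proof. by []. Qed.

(** The functions that do not involve x_1, ..., x_q. *)
Definition fixed q (u : F) := forall k, (0 < k <= q)%N -> E k u = u.

Lemma fixed_subfield q : subfield (fixed q).
Proof.
split=> [k _|u v hu hv k kq|u v hu hv k kq|u hu k kq].
- exact: rmorph1.
- by rewrite rmorphB hu // hv.
- by rewrite rmorphM hu // hv.
- by rewrite fmorphV hu.
Qed.

Lemma fixedW q r u : (q <= r)%N -> fixed r u -> fixed q u.
Proof. by move=> qr hu k /andP[k0 kq]; rewrite hu // k0 (leq_trans kq). Qed.

Lemma fixed_b q l : (q <= p)%N -> fixed q (b l).
Proof. by move=> qp k /andP[k0 kq]; rewrite (shift_b H) // k0 (leq_trans kq). Qed.

Lemma fixed_x q l : (q <= p)%N -> (q < l)%N -> fixed q (x l).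
Proof.
move=> qp ql k /andP[k0 kq]; rewrite (shift_x H) ?k0 ?(leq_trans kq) //.
  by rewrite ltn_eqF ?addr0 // (leq_ltn_trans kq).
by rewrite (leq_trans _ ql).
Qed.

Lemma shiftVC k l : (0 < k <= p)%N -> (0 < l <= p)%N ->
  forall f, E' k (E l f) = E l (E' k f).
Proof.
move=> hk hl f; apply: (can_inj (shiftK H hk)).
by rewrite (shiftVK H hk) (shiftC H) // (shiftVK H hk).
Qed.

Lemma fixed_shift q l u :
  (0 < l <= p)%N -> (q <= p)%N -> fixed q u -> fixed q (E l u).
Proof.
move=> hl qp hu k /andP[k0 kq]; have hk : (0 < k <= p)%N by rewrite k0 (leq_trans kq).
by rewrite (shiftC H) // hu // k0 kq.
Qed.

Lemma fixed_shiftV q l u :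
  (0 < l <= p)%N -> (q <= p)%N -> fixed q u -> fixed q (E' l u).
Proof.
move=> hl qp hu k /andP[k0 kq]; have hk : (0 < k <= p)%N by rewrite k0 (leq_trans kq).
by rewrite -shiftVC // hu // k0 kq.
Qed.

Lemma fixed_V q k u : (q <= p)%N -> (0 < k <= q)%N -> fixed q u -> E' k u = u.
Proof.
move=> qp /andP[k0 kq] hu; have hk : (0 < k <= p)%N by rewrite k0 (leq_trans kq).
by apply: (can_inj (shiftK H hk)); rewrite (shiftVK H hk) hu // k0 kq.
Qed.

Lemma moment_shift q l k f : (q < l <= p)%N ->
  E l (moment q k f) = moment q k (E l f).
Proof.
case/andP=> ql lp; have hl : (0 < l <= p)%N by rewrite lp (leq_trans _ ql).
elim: q ql k f => [|q IH] ql k f; first exact: rmorph0.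
have hq : (0 < q.+1 <= p)%N by rewrite (leq_trans (ltnW ql)).
have xf : E l (x q.+1) = x q.+1.
  by rewrite (shift_x H) // gtn_eqF ?addr0.
have wf t : E l (weight (b q.+1) t) = weight (b q.+1) (E l t).
  by rewrite /weight !(rmorphD, rmorphM, fmorphV, rmorph_nat, rmorph1) /= (shift_b H).
rewrite /= /extend 2!rmorphD 4!rmorphM /= !rmorphXn !wf.
rewrite !(ladder_morph _ _ (fun k f => IH (ltnW ql) k f)) ?(shift_b H) //.
rewrite !(rmorphD, rmorphB, rmorphN) /= (IH (ltnW ql)) xf !(shift_b H) //.
by rewrite -(shiftC H hl hq) -(shiftVC hq hl).
Qed.

Lemma moment_shiftV q l k f : (q < l <= p)%N ->
  E' l (moment q k f) = moment q k (E' l f).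
Proof.
move=> hl'; have [ql lp] := andP hl'.
have hl : (0 < l <= p)%N by rewrite lp (leq_trans _ ql).
by apply: (can_inj (shiftK H hl)); rewrite moment_shift // !(shiftVK H hl).
Qed.

(** If it vanished, so would its image under E k, which exceeds it by 2. *)
Lemma double_x_neq0 k (n : int) :
  (0 < k <= p)%N -> 2%:R * x k + b k + n%:~R != 0.
Proof.
move=> hk; have [k0 _] := andP hk.
apply/eqP => h; have := congr1 (E k) h; have := shift_char0 H 1.
rewrite !(rmorphD, rmorphM, rmorph_nat, rmorph_int, rmorph0) /=.
rewrite (shift_x H) // (shift_b H) // eqxx => /eqP h2 h3; apply: h2.
have h3' : 2%:R * (x k + 1) + b k + n%:~R = 0 by exact: h3.
have -> : 2%:R = (2%:R * (x k + 1) + b k + n%:~R)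
  - (2%:R * x k + b k + n%:~R) :> F by ring.
by rewrite h3' h subr0.
Qed.

Lemma moment_step q : (q < p)%N ->
  racah_triple (fixed q) (b 0%N) (moment q) ->
  level_step (fixed q) (b 0%N) (x q.+1) (b q.+1) (moment q) (E q.+1) (E' q.+1).
Proof.
move=> qp HT; have hq : (0 < q.+1 <= p)%N by [].
have q1 : (q < q.+1 <= p)%N by rewrite ltnSn.
have qpW := ltnW qp.
split=> //.
- exact: fixed_subfield.
- by split; [exact: fixed_b | exact: fixed_x | exact: fixed_b].
- by split; [exact: (shiftK H) | exact: (shiftVK H)].
- by move=> u hu; split; [exact: fixed_shift | exact: fixed_shiftV].
- by move=> k f; split; [exact: moment_shift | exact: moment_shiftV].
- by rewrite (shift_x H) // eqxx !(shift_b H).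
- by move=> n; apply: double_x_neq0.
Qed.

Lemma moment_triple q : (q <= p)%N -> racah_triple (fixed q) (b 0%N) (moment q).
Proof.
elim: q => [|q IH] qp.
  split=> [k f g|k c f _|M c f _ _|M c f _ _ A B] /=;
    rewrite ?/A ?/B /casimir /ladder; ring.
have hq : (0 < q.+1 <= p)%N by [].
have step := moment_step qp (IH (ltnW qp)).
apply: (racah_triple_sub _ (extend_racah_triple step)).
move=> u hu; split; first exact: fixedW hu.
  by apply: hu; rewrite /= leqnn.
by apply: (fixed_V qp _ hu); rewrite /= leqnn.
Qed.

(** The operator L_q, with M = x_(q+1). *)
Definition level_casimir q := casimir (moment q) (x q.+1) (b q.+1).

Lemma level_casimirD q f g : (q <= p)%N ->
  level_casimir q (f + g) = level_casimir q f + level_casimir q g.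
Proof. by move=> qp; exact: (casimirD (moment_triple qp)). Qed.

Lemma level_casimirZ q u f : (q <= p)%N -> fixed q u ->
  level_casimir q (u * f) = u * level_casimir q f.
Proof. by move=> qp hu; exact: (casimirZ (moment_triple qp)). Qed.

Lemma level_casimir_shift q l f : (q.+1 < l <= p)%N ->
  E l (level_casimir q f) = level_casimir q (E l f).
Proof.
case/andP=> ql lp; have hl : (0 < l <= p)%N by rewrite lp (leq_trans _ ql).
rewrite /level_casimir casimir_morph => [|k g]; last first.
  by rewrite moment_shift // (ltnW ql).
by rewrite (shift_b H) // (shift_x H) // gtn_eqF ?addr0.
Qed.

Lemma level_casimir_shiftV q l f : (q.+1 < l <= p)%N ->
  E' l (level_casimir q f) = level_casimir q (E' l f).
Proof.
move=> hl; have [ql lp] := andP hl.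
have hl' : (0 < l <= p)%N by rewrite lp (leq_trans _ ql).
by apply: (can_inj (shiftK H hl')); rewrite level_casimir_shift // !(shiftVK H hl').
Qed.

(** For m = q + 1 this is [level_op_extend]. For larger m, the moments are made
    of those of level m - 1, of the shifts in x_m and of coefficients that do
    not involve x_1, ..., x_q. *)
Lemma level_casimir_moment q m : (q < m <= p)%N -> forall k f, (k < 3)%N ->
  level_casimir q (moment m k f) = moment m k (level_casimir q f).
Proof.
case/andP=> qm mp; have qp : (q < p)%N by exact: leq_trans mp.
have qpW := ltnW qp.
elim: m qm mp => // m IH; rewrite ltnS leq_eqVlt => /predU1P[<-|qm] mp k f k3.
  exact: (level_op_extend (moment_step qp (moment_triple qpW)) f k3).
have {}IH := IH qm (ltnW mp).
have hm : (q.+1 < m.+1 <= p)%N by rewrite ltnS qm.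
have fx : fixed q (x m.+1) by apply: fixed_x => //; exact: leqW.
have fb l : fixed q (b l) by exact: fixed_b.
have CF := fixed_subfield q.
have lad y g : fixed q y -> level_casimir q (ladder (moment m) (b 0%N) y g)
   = ladder (moment m) (b 0%N) y (level_casimir q g).
  move=> fy; have fb0 := fb 0%N.
  rewrite /ladder -[X in X + _]addrA !level_casimirD //.
  have f1 : fixed q (y * (y + 1)) by in_subfield.
  have f2 : fixed q (2%:R * y + 1) by in_subfield.
  have f3 : fixed q (y * (y - b 0%N)) by in_subfield.
  by rewrite !level_casimirZ // !IH // addrA.
have fw t : fixed q t -> fixed q (weight (b m.+1) t).
  by move=> ft; have f1 := fb m.+1; rewrite /weight; in_subfield.
have f1 : fixed q (- x m.+1 - b m.+1) by have := fb m.+1; move=> ?; in_subfield.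
have f2 : fixed q (x m.+1 + b m.+1) by have := fb m.+1; move=> ?; in_subfield.
have f3 : fixed q (- x m.+1) by in_subfield.
have subE g h : level_casimir q (g - h) = level_casimir q g - level_casimir q h.
  by rewrite -mulN1r level_casimirD // level_casimirZ ?mulN1r //; in_subfield.
rewrite momentS /extend !level_casimirD // IH //; congr (_ + _ + _).
  rewrite level_casimirZ ?lad ?subE ?level_casimir_shift //.
  by apply: (subfieldM CF); [exact: fw | exact: (subfieldX CF)].
rewrite level_casimirZ ?lad ?subE ?level_casimir_shiftV //.
by apply: (subfieldM CF); [exact: fw | exact: (subfieldX CF)].
Qed.

Lemma level_casimir_commute_lt i j f : (i < j <= p)%N ->
  level_casimir i (level_casimir j f) = level_casimir j (level_casimir i f).
Proof.
case/andP=> ij jp; have ip : (i <= p)%N by exact: leq_trans (ltnW ij) jp.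
have fx : fixed i (x j.+1) by apply: fixed_x => //; exact: leqW.
have fb : fixed i (b j.+1) by exact: fixed_b.
have CF := fixed_subfield i; have hij : (i < j <= p)%N by rewrite ij.
have quadE g : level_casimir j g = x j.+1 * (x j.+1 + b j.+1) * moment j 0%N g
    + - b j.+1 * moment j 1%N g + -1 * moment j 2%N g.
  by rewrite /level_casimir /casimir; ring.
rewrite !quadE 2!(level_casimirD _ _ ip) !level_casimirZ //; try in_subfield.
by rewrite !level_casimir_moment.
Qed.

Lemma level_casimir_commute i j f : (i <= p)%N -> (j <= p)%N ->
  level_casimir i (level_casimir j f) = level_casimir j (level_casimir i f).
Proof.
move=> ip jp; case: (ltngtP i j) => [ij|ji|-> //].
  by rewrite level_casimir_commute_lt ?ij.
by rewrite -level_casimir_commute_lt ?ji.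
Qed.

Variable n : nat -> nat.
Definition degree q := (\sum_(i < q) n i)%N.

(** The first q factors of the multivariable polynomial, with M and c in place
    of x_(q+1) and b_(q+1). *)
Fixpoint racah_product q (M c : F) : F :=
  if q is q'.+1 then
    racah_product q' (x q) (b q)
    * racah_factor (n q') (b 0%N) (degree q')%:R (b q) M c (x q)
  else 1.

Lemma racah_product_refl q M c :
  racah_product q (- M - c) c = racah_product q M c.
Proof. by case: q => //= q; rewrite racah_factor_refl. Qed.

Lemma racah_product_shift q (s : {rmorphism F -> F}) M c : 
  (forall k, (k <= q)%N -> s (b k) = b k) ->
  (forall k, (0 < k <= q)%N -> s (x k) = x k) ->
  s (racah_product q M c) = racah_product q (s M) (s c).
Proof.
elim: q M c => [|q IH] M c sb sx; first exact: rmorph1.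
rewrite rmorphM IH ?sb ?sx ?leqnn //; first last.
- by move=> k /andP[k0 kq]; rewrite sx // k0 leqW.
- by move=> k kq; rewrite sb // leqW.
by congr (_ * _); rewrite racah_factor_morph !sb ?sx ?leqnn.
Qed.

(** The relation with the ladder operator is what makes the induction work: for
    M = z and M = - z - b it says that raise_op and lower_op, whose shifts turn
    racah_product q z into racah_product q (z + 1) and (z - 1), act on
    racah_product q z by scalars. *)
Lemma racah_product_eigen q M c : (q <= p)%N -> fixed q M -> fixed q c ->
  casimir (moment q) M c (racah_product q M c)
    = - (degree q)%:R * ((degree q)%:R - 1 + c - b 0%N) * racah_product q M c
  /\ ladder (moment q) (b 0%N) (M + c) (racah_product q (M + 1) c)
    = ladder_value (b 0%N) (degree q)%:R c M * racah_product q M c.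
Proof.
elim: q M c => [|q IH] M c qp fM fc.
  by rewrite /casimir /ladder /degree big_ord0 /ladder_value /=; split; ring.
have qpW := ltnW qp; have {}IH := IH _ _ qpW.
have hq : (0 < q.+1 <= p)%N by [].
set z := x q.+1; set b' := b q.+1; set b0 := b 0%N.
have fz : fixed q z by exact: fixed_x.
have fb : fixed q b' by exact: fixed_b.
have CF := fixed_subfield q.
have EzE : E q.+1 z = z + 1 by rewrite (shift_x H) // eqxx.
have step := moment_step qp (moment_triple qpW).
set Phi := racah_product q z b'.
have EPhi : E q.+1 Phi = racah_product q (z + 1) b'.
  rewrite racah_product_shift ?EzE ?(shift_b H) // => k kq.
    exact: (shift_b H).
  by have [k0 kq'] := andP kq; rewrite (shift_x H) // gtn_eqF ?addr0.
have E'Phi : E' q.+1 Phi = racah_product q (- z - b' + 1) b'.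
  apply: (can_inj (shiftK H hq)); rewrite (shiftVK H hq).
  have -> : - z - b' + 1 = - (z - 1) - b' by ring.
  rewrite racah_product_refl racah_product_shift ?(shift_b H) //.
  - by rewrite rmorphB rmorph1 EzE addrK.
  - by move=> k kq; exact: (shift_b H).
  - by move=> k /andP[k0 kq']; rewrite (shift_x H) // gtn_eqF ?addr0.
set s : F := (degree q)%:R.
have opPhi e0 e1 e2 u g : fixed q g ->
  normal_form b0 z b' (moment q) (E q.+1) (E' q.+1) e0 e1 e2 u (Phi * g)
  = Phi * (racah_op b0 s b' z e0 e1 e2 g (E q.+1 g) (E' q.+1 g) + u * g).
  move=> fg; rewrite mulrC /normal_form /four_term.
  have [-> -> ->] := passesP step fg.
  have -> : raise_op b0 z b' (moment q) (E q.+1) Phi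
      = ladder_value b0 s b' z * Phi.
    by rewrite /raise_op EPhi; have [_ ->] := IH z b' fz fb.
  have -> : level_op z b' (moment q) Phi = - s * (s - 1 + b' - b0) * Phi.
    by rewrite /level_op; have [-> _] := IH z b' fz fb.
  have -> : lower_op b0 z (moment q) (E' q.+1) Phi
      = ladder_value b0 s b' (- z - b') * Phi.
    have fz' : fixed q (- z - b') by in_subfield.
    rewrite /lower_op E'Phi -[X in ladder _ _ X](subrK b').
    by have [_ ->] := IH _ b' fz' fb; rewrite racah_product_refl.
  by rewrite /racah_op; ring.
have EM : E q.+1 M = M by apply: fM; rewrite /= leqnn.
have Ec : E q.+1 c = c by apply: fc; rewrite /= leqnn.
have gE m M' : E q.+1 M' = M' -> fixed q M' ->
  let g := racah_factor m b0 s b' M' c in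
  [/\ fixed q (g z), E q.+1 (g z) = g (z + 1) & E' q.+1 (g z) = g (z - 1)].
  move=> EM' fM' g; have hE (t : {rmorphism F -> F}) y :
      t b0 = b0 -> t b' = b' -> t M' = M' -> t c = c -> t (g y) = g (t y).
    by move=> h1 h2 h3 h4; rewrite /g racah_factor_morph h1 h2 h3 h4.
  have fcq : fixed q c by exact: fixedW fc.
  split.
  - by move=> k kq; rewrite hE ?fz ?fM' ?fcq ?fb // (fixed_b _ qpW kq).
  - by rewrite hE ?EzE ?(shift_b H).
  - apply: (can_inj (shiftK H hq)); rewrite (shiftVK H hq) hE ?(shift_b H) //.
    by rewrite rmorphB rmorph1 EzE addrK.
have [h0 h1 h2] :
  [/\ 2%:R * z + b' != 0, 2%:R * z + b' + 1 != 0 & 2%:R * z + b' - 1 != 0].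
  have h j := double_x_neq0 j hq.
  by split; [have := h 0 | have := h 1 | have := h (-1)]; rewrite ?addr0.
have degS : (degree q.+1)%:R = s + (n q)%:R.
  by rewrite /degree big_ord_recr natrD.
have ch0 := shift_char0 H.
have fMq : fixed q M by exact: fixedW fM.
rewrite degS /= -/z -/b' -/Phi; split.
  have [g0 g1 g2] := gE (n q) M EM fMq.
  rewrite (casimir_extend step) opPhi // g1 g2 racah_factor_casimir //.
  by rewrite mul0r addr0 mulrCA.
have fM1 : fixed q (M + 1) by in_subfield.
have EM1 : E q.+1 (M + 1) = M + 1 by rewrite rmorphD rmorph1 EM.
have [g0 g1 g2] := gE (n q) (M + 1) EM1 fM1.
rewrite (ladder_extend step) opPhi // g1 g2.
by rewrite racah_factor_ladder // mulrCA.
Qed.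
End Tower.

(** * Shifts and reflections as field automorphisms *)

Section Fractions.
Variables (R : realType) (p : nat).
Local Notation P := {mpoly R[p]}.
Local Notation K := (ratfun R p).
Local Notation tofrac := (@FracField.tofrac P).

Lemma cst_is_zmod_morphism : zmod_morphism (@cst R p).
Proof. by move=> c d; rewrite /cst mpolyCB rmorphB. Qed.

Lemma cst_is_monoid_morphism : monoid_morphism (@cst R p).
Proof.
split; first by rewrite /cst mpolyC1 rmorph1.
by move=> c d; rewrite /cst mpolyCM rmorphM.
Qed.

HB.instance Definition _ :=
  GRing.isZmodMorphism.Build R K (@cst R p) cst_is_zmod_morphism.
HB.instance Definition _ :=
  GRing.isMonoidMorphism.Build R K (@cst R p) cst_is_monoid_morphism.

Lemma mpoly_rmorph_ext (A : comNzRingType) (f g : {rmorphism P -> A}) :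
  (forall c, f c%:MP = g c%:MP) -> (forall i, f 'X_i = g 'X_i) -> f =1 g.
Proof.
move=> fgC fgX q; rewrite (mpolyE q) !rmorph_sum; apply: eq_bigr => m _.
rewrite -mul_mpolyC !rmorphM fgC mpolyXE_id !rmorph_prod; congr (_ * _).
by apply: eq_bigr => i _; rewrite !rmorphXn fgX.
Qed.

Lemma frac_repr (f : K) : f = tofrac \n_(repr f) / tofrac \d_(repr f).
Proof.
have d0 := denom_ratioP (repr f).
rewrite -[LHS]reprK; unlock FracField.tofrac.
rewrite -[X in _ = _ * X]FracField.pi_inv -[RHS]FracField.pi_mul.
rewrite /FracField.mulf /FracField.invf !numden_Ratio ?oner_eq0 //.
by rewrite mulr1 mul1r Ratio_numden.
Qed.

Lemma ratfun_rmorph_ext (f g : {rmorphism K -> K}) :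
  (forall c, f (cst c) = g (cst c)) -> (forall i, f (indet i) = g (indet i)) ->
  f =1 g.
Proof.
move=> fgC fgX u; have h : f \o tofrac =1 g \o tofrac.
  by apply: mpoly_rmorph_ext; [exact: fgC | exact: fgX].
by rewrite (frac_repr u) !fmorph_div; congr (_ / _); exact: h.
Qed.

(** Invertibility makes the h_i algebraically independent, which [fsubst] needs
    in order not to send a denominator to 0. *)
Definition affine_invertible (h : 'I_p -> K) : Prop :=
  exists hp hq : 'I_p -> P, (forall i, h i = tofrac (hp i)) /\
    (forall i, mmap (@mpolyC p R) hq (hp i) = 'X_i).

Section Subst.
Variable h : 'I_p -> K.
Hypothesis hh : affine_invertible h.

Lemma mmap_neq0 q : q != 0 -> mmap (@cst R p) h q != 0.
Proof.
have [hp [hq [hE hK]]] := hh.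
have -> : mmap cst h q = tofrac (mmap (@mpolyC p R) hp q).
  apply: (mpoly_rmorph_ext (f := mmap cst h)
    (g := tofrac \o mmap (@mpolyC p R) hp)).
    by move=> c; rewrite /= !mmapC.
  by move=> i; rewrite /= !mmapX !mmap1U.
rewrite tofrac_eq0; apply: contraNneq => q0.
have : mmap (@mpolyC p R) hq (mmap (@mpolyC p R) hp q) = q.
  apply: (mpoly_rmorph_ext (g := idfun)
    (f := mmap (@mpolyC p R) hq \o mmap (@mpolyC p R) hp)).
    by move=> c; rewrite /= !mmapC.
  by move=> i; rewrite /= !mmapX !mmap1U.
by rewrite q0 mmap0 => <-.
Qed.

Lemma fsubst_frac a d : d != 0 ->
  fsubst h (tofrac a / tofrac d) = mmap cst h a / mmap cst h d.
Proof.
move=> d0; rewrite /fsubst; set f : K := tofrac a / tofrac d.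
have e0 := denom_ratioP (repr f).
apply/eqP; rewrite eqr_div ?mmap_neq0 // -!rmorphM /=; apply/eqP; congr mmap.
apply/eqP; rewrite -tofrac_eq !rmorphM /= -eqr_div ?tofrac_eq0 //.
by rewrite -frac_repr.
Qed.

Lemma fsubst_is_zmod_morphism : zmod_morphism (fsubst h).
Proof.
move=> u v; rewrite {1}(frac_repr u) {1}(frac_repr v).
have u0 := denom_ratioP (repr u); have v0 := denom_ratioP (repr v).
rewrite -mulNr addf_div ?tofrac_eq0 // -rmorphN -!rmorphM -rmorphD.
rewrite fsubst_frac ?mulf_neq0 // rmorphD !rmorphM rmorphN /=.
by rewrite -addf_div ?mmap_neq0 // mulNr.
Qed.

Lemma fsubst_is_monoid_morphism : monoid_morphism (fsubst h).
Proof.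
split.
  rewrite -[1](divr1 1) -[1 in X in fsubst h X](rmorph1 tofrac).
  by rewrite fsubst_frac ?oner_eq0 // rmorph1 divr1.
move=> u v; rewrite {1}(frac_repr u) {1}(frac_repr v).
have u0 := denom_ratioP (repr u); have v0 := denom_ratioP (repr v).
rewrite mulf_div -!rmorphM.
by rewrite fsubst_frac ?mulf_neq0 // !rmorphM /= -mulf_div.
Qed.

Definition fsubst_rmorph : {rmorphism K -> K} :=
  HB.pack_for {rmorphism K -> K} (fsubst h)
    (GRing.isZmodMorphism.Build K K (fsubst h) fsubst_is_zmod_morphism)
    (GRing.isMonoidMorphism.Build K K (fsubst h) fsubst_is_monoid_morphism).

Lemma fsubst_cst c : fsubst h (cst c) = cst c.
Proof.
rewrite -[X in fsubst h X]divr1 -(rmorph1 tofrac) fsubst_frac ?oner_eq0 //.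
by rewrite mmapC rmorph1 divr1.
Qed.

Lemma fsubst_indet i : fsubst h (indet i) = h i.
Proof.
rewrite -[X in fsubst h X]divr1 -(rmorph1 tofrac) fsubst_frac ?oner_eq0 //.
by rewrite mmapX mmap1U rmorph1 divr1.
Qed.
End Subst.

Lemma shift_affine (nu : 'I_p -> int) :
  affine_invertible (fun i => indet i + (nu i)%:~R).
Proof.
exists (fun i => 'X_i + (nu i)%:~R), (fun i => 'X_i - (nu i)%:~R); split=> i.
  by rewrite rmorphD rmorph_int.
by rewrite rmorphD rmorph_int /= mmapX mmap1U subrK.
Qed.

Lemma reflect_affine (b : nat -> R) k :
  affine_invertible
    (fun i => if i.+1 == k then - indet i - cst (b k) else indet i).
Proof.
pose hp (i : 'I_p) : P := if i.+1 == k then - 'X_i - (b k)%:MP else 'X_i.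
exists hp, hp; split=> i; rewrite /hp; case: ifP => [e|e] //.
- by rewrite rmorphB rmorphN.
- by rewrite rmorphB rmorphN /= mmapC mmapX mmap1U e; ring.
- by rewrite mmapX mmap1U e.
Qed.

Definition shift_rmorph nu : {rmorphism K -> K} :=
  fsubst_rmorph (shift_affine nu).

Lemma shift_rmorphE nu f : shift_rmorph nu f = shift nu f.
Proof. by []. Qed.

Lemma shift_cst nu c : shift nu (cst c) = cst c :> K.
Proof. exact: (fsubst_cst (shift_affine nu)). Qed.

Lemma shift_indet nu i : shift nu (indet i) = indet i + (nu i)%:~R :> K.
Proof. exact: (fsubst_indet (shift_affine nu)). Qed.

Lemma shift_shift (nu nu' : 'I_p -> int) (f : K) :
  shift nu (shift nu' f) = shift (fun i => nu i + nu' i) f.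
Proof.
apply: (@ratfun_rmorph_ext (shift_rmorph nu \o shift_rmorph nu')
  (shift_rmorph (fun i => nu i + nu' i))) => [c|i].
  change (shift nu (shift nu' (cst c))
    = shift (fun i => nu i + nu' i) (cst c) :> K).
  by rewrite !shift_cst.
change (shift nu (shift nu' (indet i))
  = shift (fun i => nu i + nu' i) (indet i) :> K).
rewrite !shift_indet -shift_rmorphE !rmorphD !rmorph_int.
by rewrite shift_rmorphE shift_indet addrA.
Qed.

Lemma shift_eq (nu nu' : 'I_p -> int) :
  nu =1 nu' -> shift nu =1 shift nu' :> (K -> K).
Proof.
move=> e; apply: (@ratfun_rmorph_ext (shift_rmorph nu) (shift_rmorph nu'))
  => [c|i].
  by rewrite !shift_rmorphE !shift_cst.
by rewrite !shift_rmorphE !shift_indet e.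
Qed.

Lemma shift_id (nu : 'I_p -> int) :
  (forall i, nu i = 0) -> shift nu =1 id :> (K -> K).
Proof.
move=> e; apply: (@ratfun_rmorph_ext (shift_rmorph nu) idfun) => [c|i].
  by rewrite shift_rmorphE shift_cst.
by rewrite shift_rmorphE shift_indet e addr0.
Qed.

Variables (b : nat -> R) (N : R).
Local Notation x := (@xvar R p N).

Definition Eup k := shift_rmorph (unitv k).
Definition Edown k := shift_rmorph (fun i => - unitv k i).

Lemma xvar_spec l : (0 < l)%N ->
  (exists2 i : 'I_p, i.+1 = l & x l = indet i) \/ ((p < l)%N /\ x l = cst N).
Proof.
case: l => // l _; rewrite /xvar /=; case: insubP => [i lp il|].
  by left; exists i; rewrite ?il.
by rewrite -leqNgt; right.
Qed.

Lemma racah_shift_system :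
  shift_system p x (fun k => cst (b k)) Eup Edown.
Proof.
split.
- move=> k _ f; rewrite !shift_rmorphE shift_shift; apply: shift_id => i.
  exact: addNr.
- move=> k _ f; rewrite !shift_rmorphE shift_shift; apply: shift_id => i.
  exact: addrN.
- move=> k l _ _ f; rewrite !shift_rmorphE !shift_shift.
  by apply: shift_eq => i; rewrite addrC.
- move=> k l /andP[k0 kp] l0.
  case: (xvar_spec l0) => [[i il ->]|[lp ->]]; rewrite shift_rmorphE.
    by rewrite shift_indet /unitv il eq_sym; case: eqP.
  by rewrite shift_cst ltn_eqF ?addr0 // (leq_ltn_trans kp).
- by move=> k l _; exact: shift_cst.
- move=> k; by rewrite -(rmorph_nat (@cst R p)) fmorph_eq0 pnatr_eq0.
Qed.

Section Product.
Variable n : 'I_p -> nat.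
Let nn k := oapp n 0%N (insub k).
Local Notation B := (fun k => cst (b k) : K).
Let G k : K := racah_factor (nn k) (B 0%N) (degree nn k)%:R
  (B k.+1) (x k.+2) (B k.+2) (x k.+1).

Lemma degree_psum j : (j <= p)%N -> degree nn j = psum n j.
Proof.
move=> jp; rewrite /degree (big_ord_widen _ nn jp); apply: eq_bigr => i _.
by rewrite /nn valK.
Qed.

Lemma racah_product_prod j :
  racah_product x B nn j (x j.+1) (B j.+1) = \prod_(k < j) G k.
Proof.
elim: j => [|j IH]; first by rewrite big_ord0.
by rewrite big_ord_recr /= -IH.
Qed.

(** The factors numbered from j + 1 on involve x_(j+1), ..., x_(p+1) only. *)
Lemma Rp_split j : (j <= p)%N ->
  exists2 g : K, fixed Eup j g &
    Rp n b N = racah_product x B nn j (x j.+1) (B j.+1) * g.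
Proof.
move=> jp; exists (\prod_(j <= k < p) G k).
  move=> k kj; rewrite rmorph_prod big_nat_cond [RHS]big_nat_cond.
  apply: eq_bigr => i; rewrite andbT => /andP[ji ip].
  have fB l : Eup k (B l) = B l by exact: shift_cst.
  have H := racah_shift_system; have fx := fixed_x H jp.
  by rewrite racah_factor_morph !fB !fx // ?ltnS // leqW.
rewrite racah_product_prod -(big_mkord xpredT) -big_cat_nat // big_mkord.
apply: eq_bigr => k _; rewrite /G degree_psum ?(ltnW (ltn_ord k)) //.
by rewrite /nn valK.
Qed.
End Product.
End Fractions.

(** * The operators L_q as combinations of moment operators *)

Section Operator.
Variables (R : realType) (p : nat) (b : nat -> R) (N : R).
Local Notation K := (ratfun R p).
Local Notation x := (@xvar R p N).
Local Notation B := (fun k => cst (b k) : K).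

Definition reflect_rmorph k : {rmorphism K -> K} :=
  fsubst_rmorph (@reflect_affine R p b k).
Lemma reflect_cst k c : reflect_var b k (cst c) = cst c :> K.
Proof. exact: (fsubst_cst (@reflect_affine R p b k)). Qed.

Lemma reflect_xvar k l : (0 < l)%N -> (k <= p)%N ->
  reflect_var b k (x l) = if l == k then - x l - B l else x l.
Proof.
move=> l0 kp; case: (@xvar_spec R p N l l0) => [[i il ->]|[lp ->]].
  rewrite [LHS](fsubst_indet (@reflect_affine R p b k)) il.
  by case: eqP => [->|].
by rewrite reflect_cst gtn_eqF // (leq_ltn_trans kp).
Qed.

HB.instance Definition _ := Monoid.isLaw.Build (K -> K) id (@comp K K K)
  (fun _ _ _ => erefl) (fun _ => erefl) (fun _ => erefl).

Lemma widen_lift_max q (i : 'I_q) : widen_ord (leqnSn q) i = lift ord_max i.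
Proof. by apply: val_inj; rewrite [RHS]lift_max. Qed.

Definition restrict (T : Type) q (nu : {ffun 'I_q.+1 -> T}) :
  {ffun 'I_q -> T} :=
  [ffun i => nu (lift ord_max i)].

Lemma opprodS q (nu : {ffun 'I_q.+1 -> bool}) (T : nat -> K -> K) f :
  opprod nu T f
  = opprod (restrict nu) T (if nu ord_max then T q.+1 f else f).
Proof.
rewrite /opprod big_mkcond big_ord_recr /= [in RHS]big_mkcond.
have -> : \big[comp/id]_(i < q)
      (if nu (widen_ord (leqnSn q) i) then T i.+1 else id)
    = \big[comp/id]_(i < q) (if restrict nu i then T i.+1 else id).
  by apply: eq_bigr => i _; rewrite ffunE widen_lift_max.
by case: (nu ord_max).
Qed.

Lemma opprod_ind (Q : (K -> K) -> Prop) q (nu : {ffun 'I_q -> bool}) T :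
  Q id -> (forall f g, Q f -> Q g -> Q (f \o g)) ->
  (forall k, (0 < k <= q)%N -> Q (T k)) -> Q (opprod nu T).
Proof. by move=> Q1 QM QT; apply: big_ind => // i _; apply: QT => /=. Qed.

Lemma positionsS q (nu : {ffun 'I_q.+1 -> bool}) :
  positions nu = if nu ord_max then rcons (positions (restrict nu)) q.+1
                 else positions (restrict nu).
Proof.
rewrite /positions enum_ordSr filter_rcons filter_map.
have -> : [seq i <- enum 'I_q | preim (widen_ord (leqnSn q)) [pred i | nu i] i]
    = [seq i <- enum 'I_q | restrict nu i].
  by apply: eq_filter => i /=; rewrite ffunE widen_lift_max.
by case: (nu ord_max); rewrite ?map_rcons -map_comp.
Qed.

(** The coefficient A_nu without its last factor, for the positions l, and with
    an arbitrary point t_k in place of x_k: reflections act through t. *)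
Definition chain (t : nat -> K) (l : seq nat) : K :=
  let s := size l in let i k := nth 0%N l k.-1 in
  (t (i 1%N) + B (i 1%N) - B 0%N) * (t (i 1%N) + B (i 1%N))
  * ((\prod_(2 <= k < s.+1)
        ((t (i k) + t (i k.-1) + B (i k))
         * (t (i k) + t (i k.-1) + B (i k) + 1)))
     / (\prod_(1 <= k < s.+1)
          ((2%:R * t (i k) + B (i k)) * (2%:R * t (i k) + B (i k) + 1)))).

Lemma coefA01E q M nu :
  @coefA01 R p N b q M nu = let l := positions nu in let z := x (last 0%N l) in
  chain x l * (z + B q.+1 + M) * (M - z).
Proof. by rewrite /coefA01 /chain nth_last. Qed.

Lemma chain1 t i : chain t [:: i] =
  (t i + B i - B 0%N) * (t i + B i) * weight (B i) (t i).
Proof. by rewrite /chain /= big_geq // big_nat1 mul1r. Qed.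

Lemma chain_rcons t l i : l != [::] -> chain t (rcons l i) =
  chain t l * ((t i + B i + t (last 0%N l)) * (t i + B i + t (last 0%N l) + 1))
  * weight (B i) (t i).
Proof.
case: l => // j l _; rewrite /chain size_rcons /=.
set s := (size l).+1.
rewrite big_nat_recr //= [X in _ / X]big_nat_recr //=.
have hn k : (0 < k < s.+1)%N ->
    nth 0%N (j :: rcons l i) k.-1 = nth 0%N (j :: l) k.-1.
  case: k => // k; rewrite !ltnS => /= ks.
  by rewrite -rcons_cons nth_rcons /= ltnS ks.
have P1 : \prod_(2 <= k < s.+1)
      ((t (nth 0%N (j :: rcons l i) k.-1) + t (nth 0%N (j :: rcons l i) k.-2)
        + B (nth 0%N (j :: rcons l i) k.-1))
       * (t (nth 0%N (j :: rcons l i) k.-1) + t (nth 0%N (j :: rcons l i) k.-2)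
        + B (nth 0%N (j :: rcons l i) k.-1) + 1))
  = \prod_(2 <= k < s.+1)
      ((t (nth 0%N (j :: l) k.-1) + t (nth 0%N (j :: l) k.-2)
        + B (nth 0%N (j :: l) k.-1))
       * (t (nth 0%N (j :: l) k.-1) + t (nth 0%N (j :: l) k.-2)
        + B (nth 0%N (j :: l) k.-1) + 1)).
  apply: eq_big_nat => k /andP[k2 ks]; rewrite !hn //.
    by rewrite (leq_ltn_trans (leq_pred k)) // andbT -ltnS (ltn_predK k2).
  by rewrite ks (ltnW k2).
have P2 : \prod_(1 <= k < s.+1)
      ((2%:R * t (nth 0%N (j :: rcons l i) k.-1)
        + B (nth 0%N (j :: rcons l i) k.-1))
       * (2%:R * t (nth 0%N (j :: rcons l i) k.-1)
        + B (nth 0%N (j :: rcons l i) k.-1) + 1))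
  = \prod_(1 <= k < s.+1)
      ((2%:R * t (nth 0%N (j :: l) k.-1) + B (nth 0%N (j :: l) k.-1))
       * (2%:R * t (nth 0%N (j :: l) k.-1) + B (nth 0%N (j :: l) k.-1) + 1)).
  by apply: eq_big_nat => k hk; rewrite !hn.
rewrite {}P1 {}P2 nth_rcons ltnn eqxx (hn s) ?ltnSn //.
rewrite -[s.-1]/((size (j :: l)).-1) nth_last /= invfM /weight; ring.
Qed.

Lemma chain_eq (t t' : nat -> K) l : l != [::] ->
  {in l, t =1 t'} -> chain t l = chain t' l.
Proof.
case/lastP: l => // l i _; elim/last_ind: l i => [|l j IH] i tt'.
  by rewrite !chain1 tt' ?mem_head.
have l0 : rcons l j != [::] by case: (l).
rewrite (chain_rcons t i l0) (chain_rcons t' i l0) last_rcons IH; last first.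
  by move=> k kl; apply: tt'; rewrite mem_rcons inE kl orbT.
by rewrite !tt' // !mem_rcons !inE ?mem_rcons ?inE eqxx ?orbT.
Qed.

Lemma chain_ext (t t' : nat -> K) l : t =1 t' -> chain t l = chain t' l.
Proof.
move=> tt'; case: l => [|i l]; last by apply: chain_eq => // k _.
by rewrite /chain /= !tt' !big_geq.
Qed.

Lemma chain_morph (g : {rmorphism K -> K}) (t : nat -> K) l :
  (forall c, g (cst c) = cst c) -> g (chain t l) = chain (g \o t) l.
Proof.
move=> gc; rewrite /chain [g (_ * _)]rmorphM [g (_ * (_ + _))]rmorphM.
rewrite [g (_ / _)]rmorphM fmorphV !rmorph_prod !(rmorphB, rmorphD) /= !gc.
congr (_ * (_ / _)); apply: eq_bigr => k _;
  by rewrite rmorphM !rmorphD ?rmorphM ?rmorph1 ?rmorph_nat /= !gc.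
Qed.

Section SignedMoment.
Variable q : nat.
Implicit Type nu : {ffun 'I_q -> 'I_3}.

Definition supp nu : {ffun 'I_q -> bool} :=
  [ffun i => nonneg_part nu i || nonpos_part nu i].

(** x_k, or - x_k - b_k at the positions of the components -1. *)
Definition signed_point nu k : K :=
  opprod (nonpos_part nu) (reflect_var b) (x k).

Definition signed_diff nu (f : K) : K :=
  opprod (nonneg_part nu) (@fdiff R p) (opprod (nonpos_part nu) (@bdiff R p) f).

(** The term of index nu in the k-th moment operator. *)
Definition summand nu k f : K :=
  let l := positions (supp nu) in let t := signed_point nu in
  (-1) ^+ (\sum_(i < q) nonpos_part nu i)%N * (chain t l * t (last 0%N l) ^+ k)
  * signed_diff nu f.

Definition signed_moment k f :=
  \sum_(nu : {ffun 'I_q -> 'I_3} | [exists i, sg3 (nu i) != 0]) summand nu k f.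

Lemma reflections_rmorph (nu : {ffun 'I_q -> bool}) :
  exists g : {rmorphism K -> K}, opprod nu (reflect_var b) =1 g.
Proof.
apply: (opprod_ind (Q := fun phi => exists g : {rmorphism K -> K}, phi =1 g)).
- by exists idfun.
- by move=> f g [f' hf] [g' hg]; exists (f' \o g') => u /=; rewrite hg hf.
- by move=> k _; exists (reflect_rmorph k).
Qed.

Lemma opprod_id (nu : {ffun 'I_q -> bool}) T u :
  (forall k, (0 < k <= q)%N -> T k u = u) -> opprod nu T u = u :> K.
Proof.
move=> h; apply: (opprod_ind (Q := fun phi => phi u = u)) => //.
by move=> f g hf hg /=; rewrite hg hf.
Qed.

Lemma Lop_casimir (M f : K) :
  (forall k, (0 < k <= q)%N -> reflect_var b k M = M) ->
  Lop N b q M f = casimir signed_moment M (B q.+1) f.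
Proof.
move=> hM; rewrite /Lop /casimir /signed_moment !mulr_sumr -!sumrB.
apply: eq_bigr => nu _.
rewrite /summand -/(signed_diff nu f) /coefA coefA01E -/(supp nu).
have [g hg] := reflections_rmorph (nonpos_part nu).
have gc c : g (cst c) = cst c.
  by rewrite -hg; apply: opprod_id => k _; exact: reflect_cst.
have gM : g M = M by rewrite -hg; exact: opprod_id.
rewrite hg; cbv zeta; rewrite 2!rmorphM rmorphB 2!rmorphD chain_morph // gM gc.
have e : g \o x =1 signed_point nu by move=> k; rewrite /signed_point hg.
rewrite (chain_ext _ e) /= !(e _ : g (x _) = _); ring.
Qed.
End SignedMoment.

Section Recursion.
Variable q : nat.
Hypothesis qp : (q < p)%N.
Implicit Type nu : {ffun 'I_q -> 'I_3}.
Let z := x q.+1.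
Let c := B q.+1.

Definition append_sign nu (t : 'I_3) : {ffun 'I_q.+1 -> 'I_3} :=
  [ffun i => oapp nu t (unlift ord_max i)].

Lemma append_sign_max nu t : append_sign nu t ord_max = t.
Proof. by rewrite ffunE unlift_none. Qed.

Lemma append_sign_lift nu t i : append_sign nu t (lift ord_max i) = nu i.
Proof. by rewrite ffunE liftK. Qed.

Lemma restrict_nonneg nu t :
  restrict (nonneg_part (append_sign nu t)) = nonneg_part nu.
Proof. by apply/ffunP => i; rewrite !ffunE liftK. Qed.

Lemma restrict_nonpos nu t :
  restrict (nonpos_part (append_sign nu t)) = nonpos_part nu.
Proof. by apply/ffunP => i; rewrite !ffunE liftK. Qed.

Lemma restrict_supp nu t : restrict (supp (append_sign nu t)) = supp nu.
Proof. by apply/ffunP => i; rewrite !ffunE liftK. Qed.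

Lemma sum_append_sign (V : nmodType) (F : {ffun 'I_q.+1 -> 'I_3} -> V) :
  \sum_u F u
  = \sum_(t : 'I_3) \sum_(nu : {ffun 'I_q -> 'I_3}) F (append_sign nu t).
Proof.
rewrite pair_big /=.
rewrite (reindex (fun u : 'I_3 * {ffun 'I_q -> 'I_3} => append_sign u.2 u.1)) //.
exists (fun u : {ffun 'I_q.+1 -> 'I_3} => (u ord_max, restrict u))
  => [[t nu]|u] _ /=.
  rewrite append_sign_max; congr pair; apply/ffunP => i; rewrite ffunE.
  exact: append_sign_lift.
apply/ffunP => i; rewrite ffunE; case: unliftP => [j ->|->] //=.
by rewrite ffunE.
Qed.

Lemma exists_append_sign nu t :
  [exists i, sg3 (append_sign nu t i) != 0] =
  (sg3 t != 0) || [exists i, sg3 (nu i) != 0].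
Proof.
apply/existsP/orP => [[i]|[ht|/existsP[i hi]]].
- case: (unliftP ord_max i) => [j ->|->];
    rewrite ?append_sign_lift ?append_sign_max => h.
    by right; apply/existsP; exists j.
  by left.
- by exists ord_max; rewrite append_sign_max.
- by exists (lift ord_max i); rewrite append_sign_lift.
Qed.

Lemma sign_append_sign nu t :
  (\sum_(i < q.+1) nonpos_part (append_sign nu t) i
   = \sum_(i < q) nonpos_part nu i + (sg3 t == (-1)%R))%N.
Proof.
rewrite big_ord_recr /= [in X in (_ + X)%N]ffunE append_sign_max.
congr (_ + _)%N.
by apply: eq_bigr => i _; rewrite widen_lift_max !ffunE liftK.
Qed.

Lemma summand_append0 nu t k f : sg3 t = 0 ->
  summand (append_sign nu t) k f = summand nu k f.
Proof.
move=> t0; rewrite /summand sign_append_sign t0 addn0.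
have hp : positions (supp (append_sign nu t)) = positions (supp nu).
  by rewrite positionsS restrict_supp !ffunE unlift_none /= t0.
have ht : signed_point (append_sign nu t) =1 signed_point nu.
  move=> l; rewrite /signed_point opprodS restrict_nonpos.
  by rewrite !ffunE unlift_none /= t0.
rewrite hp (chain_ext _ ht) ht; congr (_ * _).
rewrite /signed_diff !opprodS restrict_nonpos restrict_nonneg.
by rewrite !ffunE unlift_none /= t0.
Qed.

Lemma positions_bound (nu : {ffun 'I_q -> bool}) l :
  l \in positions nu -> (0 < l <= q)%N.
Proof. by case/mapP => i _ ->; exact: ltn_ord. Qed.

Definition sign_point (t : 'I_3) : K := if sg3 t == -1 then - z - c else z.

Lemma signed_point_last nu t :
  signed_point (append_sign nu t) q.+1 = sign_point t.
Proof.
rewrite /signed_point opprodS restrict_nonpos !ffunE unlift_none /=.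
rewrite reflect_xvar // eqxx -/z -/c /sign_point.
have hz : opprod (nonpos_part nu) (reflect_var b) z = z.
  apply: opprod_id => k /andP[k0 kq].
  by rewrite reflect_xvar ?(leq_trans kq (ltnW qp)) // gtn_eqF // ltnS.
have hc : opprod (nonpos_part nu) (reflect_var b) c = c.
  by apply: opprod_id => k _; exact: reflect_cst.
case: ifP => _ //; have [g hg] := reflections_rmorph (nonpos_part nu).
by rewrite hg rmorphB rmorphN -!hg hz hc.
Qed.

Lemma signed_point_lt nu t l : (0 < l <= q)%N ->
  signed_point (append_sign nu t) l = signed_point nu l.
Proof.
case/andP=> l0 lq; rewrite /signed_point opprodS restrict_nonpos.
by case: ifP => // _; rewrite reflect_xvar // ltn_eqF.
Qed.

Definition sign_diff (t : 'I_3) f :=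
  if sg3 t == -1 then @bdiff R p q.+1 f else @fdiff R p q.+1 f.

Lemma opprod_fdiff (nu : {ffun 'I_q -> bool}) k f :
  opprod nu (@bdiff R p) (fdiff k f) = fdiff k (opprod nu (@bdiff R p) f).
Proof.
move: f; apply: (opprod_ind
  (Q := fun phi => forall f, phi (fdiff k f) = fdiff k (phi f))) => //.
- by move=> g h hg hh f /=; rewrite hh hg.
- move=> l _ f.
  pose d := @shift_rmorph R p (fun i => - unitv l i).
  pose u := @shift_rmorph R p (unitv k).
  change (u f - f - d (u f - f) = u (f - d f) - (f - d f)).
  have du : d (u f) = u (d f).
    by rewrite !shift_rmorphE !shift_shift; apply: shift_eq => i; rewrite addrC.
  rewrite !rmorphB du.
  have key (f1 f2 f3 f4 : K) : f1 - f2 - (f3 - f4) = f1 - f3 - (f2 - f4).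
    by ring.
  exact: key.
Qed.

Lemma signed_diff_append nu t f : sg3 t != 0 ->
  signed_diff (append_sign nu t) f = signed_diff nu (sign_diff t f).
Proof.
move=> t0; rewrite /signed_diff /sign_diff !opprodS restrict_nonpos restrict_nonneg.
rewrite !ffunE unlift_none /=; case: (sg3 t =P -1) => [->|tm] //=.
have -> : (sg3 t == 1) = true.
  by move: t0 tm; case: t => [[|[|[|//]]]] it.
by rewrite opprod_fdiff.
Qed.

(** The factor between the last position of nu and the new position is
    (y + t)(y + t + 1), with t the last point of nu, which the moments of order
    0, 1 and 2 take into account. *)
Lemma summand_append nu t k f :
  sg3 t != 0 -> [exists i, sg3 (nu i) != 0] ->
  let y := sign_point t + c in let g := sign_diff t f in
  summand (append_sign nu t) k f =
  (-1) ^+ (sg3 t == -1) * (weight c (sign_point t) * sign_point t ^+ k)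
  * (y * (y + 1) * summand nu 0 g + (2%:R * y + 1) * summand nu 1 g
     + summand nu 2 g).
Proof.
move=> t0 ex y g; rewrite /summand sign_append_sign signed_diff_append // -/g.
have hp : positions (supp (append_sign nu t))
    = rcons (positions (supp nu)) q.+1.
  rewrite positionsS restrict_supp !ffunE unlift_none /=.
  suff -> : (sg3 t == 1) || (sg3 t == -1) by [].
  by move: t0; case: t {y g} => [[|[|[|//]]]].
have l0 : positions (supp nu) != [::].
  case/existsP: ex => i hi; have : i.+1 \in positions (supp nu).
    apply/mapP; exists i => //; rewrite mem_filter mem_enum andbT !ffunE.
    by move: hi; case: (nu i) => [[|[|[|//]]]].
  by case: positions.
rewrite hp last_rcons signed_point_last chain_rcons // signed_point_last.
have hl : last 0%N (positions (supp nu)) \in positions (supp nu).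
  by case: (positions _) l0 => // i l _; exact: mem_last.
rewrite (signed_point_lt _ _ (positions_bound hl)).
rewrite (chain_eq (t' := signed_point nu) l0); last first.
  by move=> l /positions_bound; exact: signed_point_lt.
rewrite exprD /y; ring.
Qed.

Lemma summand_append_zero nu t k f :
  sg3 t != 0 -> ~~ [exists i, sg3 (nu i) != 0] ->
  let y := sign_point t + c in
  summand (append_sign nu t) k f =
  (-1) ^+ (sg3 t == -1) * (weight c (sign_point t) * sign_point t ^+ k)
  * (y * (y - B 0%N) * sign_diff t f).
Proof.
move=> t0 ex y; have nu0 i : sg3 (nu i) = 0.
  by apply/eqP; apply: contraNT ex => hi; apply/existsP; exists i.
have h1 i : nonneg_part nu i = false by rewrite ffunE nu0.
have h2 i : nonpos_part nu i = false by rewrite ffunE nu0.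
rewrite /summand sign_append_sign signed_diff_append // big1 => [|i _]; last first.
  by rewrite h2.
have hp : positions (supp (append_sign nu t)) = [:: q.+1].
  rewrite positionsS restrict_supp !ffunE unlift_none /=.
  have -> : positions (supp nu) = [::].
    rewrite /positions (@eq_filter _ _ pred0) ?filter_pred0 // => i.
    by rewrite ffunE h1 h2.
  suff -> : (sg3 t == 1) || (sg3 t == -1) by [].
  by move: t0; case: t {y} => [[|[|[|//]]]].
have ops T (m : {ffun 'I_q -> bool}) (g : K) :
    m =1 (fun=> false) -> opprod m T g = g.
  by move=> hm; rewrite /opprod big_pred0.
rewrite hp /= signed_point_last chain1 signed_point_last /signed_diff !ops //.
by rewrite add0n /y; ring.
Qed.

Lemma sum_signed t k f : sg3 t != 0 ->
  \sum_nu summand (append_sign nu t) k f =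
  (-1) ^+ (sg3 t == -1) * (weight c (sign_point t) * sign_point t ^+ k)
  * ladder (@signed_moment q) (B 0%N) (sign_point t + c) (sign_diff t f).
Proof.
move=> t0; rewrite (bigID (fun nu => [exists i, sg3 (nu i) != 0])) /=.
under eq_bigr => nu ex do rewrite (summand_append k f t0 ex).
rewrite -mulr_sumr !big_split /= -!mulr_sumr.
(* inord 1 encodes the component 0 *)
rewrite [X in _ + X](big_pred1 [ffun=> inord 1]) => [|nu] /=; last first.
  case: eqVneq => [->|ne].
    by apply/negP => /existsP[i]; rewrite ffunE /sg3 inordK.
  apply/negbTE; rewrite negbK; apply: contraR ne => ex; apply/eqP/ffunP => i.
  rewrite ffunE; have : sg3 (nu i) = 0.
    by apply/eqP; apply: contraNT ex => hi; apply/existsP; exists i.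
  case: (nu i) => [[|[|[|//]]]] //= hi _.
  by apply: val_inj; rewrite /= inordK.
rewrite summand_append_zero //; last first.
  by apply/negP => /existsP[i]; rewrite ffunE /sg3 inordK.
by rewrite -mulrDr.
Qed.

(** Splitting according to the last component. A component -1 carries a sign and
    a backward difference, which make E^-1 - 1. *)
Lemma signed_momentS k f :
  (forall y g h, ladder (@signed_moment q) (B 0%N) y (g - h) =
     ladder (@signed_moment q) (B 0%N) y g - ladder (@signed_moment q) (B 0%N) y h) ->
  @signed_moment q.+1 k f
  = extend (@signed_moment q) (B 0%N) (@Eup R p q.+1) (@Edown R p q.+1) z c k f.
Proof.
move=> lB; rewrite {1}/signed_moment big_mkcond sum_append_sign.
rewrite !big_ord_recl big_ord0 addr0.
under eq_bigr => nu _ do rewrite exists_append_sign.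
under [X in _ + (X + _)]eq_bigr => nu _ do rewrite exists_append_sign.
under [X in _ + (_ + X)]eq_bigr => nu _ do rewrite exists_append_sign.
rewrite !sum_signed // -big_mkcond.
under eq_bigr => nu _ do rewrite summand_append0 //.
rewrite -[\sum_(_ | _) _]/(signed_moment q k f).
have -> : sign_point ord0 = - z - c by [].
have -> : sign_point (lift ord0 (lift ord0 ord0)) = z by [].
have -> : sign_diff ord0 f = f - @Edown R p q.+1 f by [].
have -> : sign_diff (lift ord0 (lift ord0 ord0)) f = @Eup R p q.+1 f - f by [].
have key (u v l1 l2 l3 l4 m : K) :
    (-1) ^+ 1 * u * (l1 - l2) + (m + (-1) ^+ 0 * v * (l3 - l4))
    = m + v * (l3 - l4) + u * (l2 - l1) by ring.
by rewrite /extend !lB subrK; exact: key.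
Qed.
End Recursion.

Lemma signed_momentE q k f : (q <= p)%N ->
  @signed_moment q k f = moment x B (@Eup R p) (@Edown R p) q k f.
Proof.
elim: q k f => [|q IH] k f qp.
  rewrite /signed_moment big1 // => nu /existsP[[]] //.
have H := @racah_shift_system R p b N.
have T := moment_triple H (ltnW qp).
have lE y g : ladder (@signed_moment q) (B 0%N) y g
    = ladder (moment x B (@Eup R p) (@Edown R p) q) (B 0%N) y g.
  by rewrite /ladder !IH // ltnW.
rewrite signed_momentS // => [|y g h]; last first.
  by rewrite !lE (ladderB (fixed_subfield _ q) T).
by rewrite momentS /extend IH ?(ltnW qp) // !lE.
Qed.

Lemma Lx_casimir j f : (j <= p)%N ->
  Lx b N j f = level_casimir x B (@Eup R p) (@Edown R p) j f.
Proof.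
move=> jp; rewrite /Lx Lop_casimir => [|k /andP[k0 kj]].
  by rewrite /level_casimir /casimir !signed_momentE.
by rewrite reflect_xvar ?(leq_trans kj) // gtn_eqF // ltnS.
Qed.
End Operator.

(** * The algebra of difference operators *)

Section DifferenceOperators.
Variables (R : realType) (p : nat).
Local Notation K := (ratfun R p).
Local Notation exponent := {ffun 'I_p -> int}.
Implicit Types (L : K -> K).

Definition shift_sum (s : seq (K * exponent)) (f : K) : K :=
  \sum_(u <- s) u.1 * shift u.2 f.
Definition shift_op L : Prop := exists s, L =1 shift_sum s.

(** Collecting the coefficients of equal shifts. *)
Lemma shift_op_diffop L : shift_op L -> is_diffop L.
Proof.
case=> s Ls; exists (undup (map snd s)), (fun nu => \sum_(u <- s | u.2 == nu) u.1).
split=> [|f]; first exact: undup_uniq.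
under eq_bigr do rewrite mulr_suml.
rewrite Ls /shift_sum (exchange_big_dep predT) //= big_seq [RHS]big_seq.
apply: eq_bigr => u us.
have hu : u.2 \in undup (map snd s) by rewrite mem_undup map_f.
rewrite -big_filter.
have -> : [seq nu <- undup (map snd s) | u.2 == nu] = [:: u.2].
  have := filter_pred1_uniq (undup_uniq (map snd s)) hu.
  by move=> <-; apply: eq_filter => nu; rewrite eq_sym.
by rewrite big_seq1.
Qed.

Lemma shift_op_ext L L' : L =1 L' -> shift_op L -> shift_op L'.
Proof. by move=> e [s h]; exists s => f; rewrite -e. Qed.

Lemma shift_op_shift (nu : 'I_p -> int) : shift_op (shift nu).
Proof.
exists [:: (1, [ffun i => nu i])] => f; rewrite /shift_sum big_seq1 mul1r.
by apply: shift_eq => i; rewrite ffunE.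
Qed.

Lemma shift_op_id : shift_op id.
Proof. by apply: shift_op_ext (shift_op_shift (fun=> 0)); exact: shift_id. Qed.

Lemma shift_op0 : shift_op (fun=> 0).
Proof. by exists [::] => f; rewrite /shift_sum big_nil. Qed.

Lemma shift_op_scale c L : shift_op L -> shift_op (fun f => c * L f).
Proof.
case=> s h; exists [seq (c * u.1, u.2) | u <- s] => f.
by rewrite h /shift_sum big_map mulr_sumr; apply: eq_bigr => u _; rewrite mulrA.
Qed.

Lemma shift_op_add L L' :
  shift_op L -> shift_op L' -> shift_op (fun f => L f + L' f).
Proof.
case=> s h [s' h']; exists (s ++ s') => f.
by rewrite h h' /shift_sum big_cat.
Qed.

Lemma shift_op_comp L L' :
  shift_op L -> shift_op L' -> shift_op (fun f => L (L' f)).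
Proof.
case=> s h [s' h'].
exists (allpairs (fun u v : K * exponent =>
  (u.1 * shift u.2 v.1, [ffun i => u.2 i + v.2 i] : exponent)) s s') => f.
rewrite h h' /shift_sum big_allpairs_dep; apply: eq_bigr => u _ /=.
rewrite -shift_rmorphE rmorph_sum mulr_sumr; apply: eq_bigr => v _.
rewrite rmorphM mulrA !shift_rmorphE shift_shift; congr (_ * _).
by apply: shift_eq => i; rewrite ffunE.
Qed.

Lemma shift_op_ladder (X : nat -> K -> K) b0 y L :
  (forall k, shift_op (X k)) -> shift_op L ->
  shift_op (fun f => ladder X b0 y (L f)).
Proof.
move=> hX hL; have hXL k c := shift_op_scale c (shift_op_comp (hX k) hL).
have h0 := shift_op_add (hXL 0 (y * (y + 1))) (hXL 1 (2%:R * y + 1)).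
have h1 := shift_op_add (shift_op_add h0 (hXL 2 1)).
apply: shift_op_ext (h1 _ (shift_op_scale (y * (y - b0)) hL)) => f.
by rewrite /ladder mul1r.
Qed.

Lemma shift_op_moment (x b : nat -> K) q k :
  shift_op (moment x b (@Eup R p) (@Edown R p) q k).
Proof.
elim: q k => [|q IH] k; first exact: shift_op0.
have hE nu : shift_op (fun f => shift nu f - f).
  apply: shift_op_ext (shift_op_add (shift_op_shift nu)
    (shift_op_scale (-1) shift_op_id)) => f.
  by rewrite mulN1r.
rewrite momentS; apply: shift_op_add.
  apply: shift_op_add; first exact: IH.
  exact: shift_op_scale (shift_op_ladder _ _ IH (hE (unitv q.+1))).
exact: shift_op_scale (shift_op_ladder _ _ IH (hE (fun i => - unitv q.+1 i))).
Qed.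

Lemma shift_op_Lx b N j : (j <= p)%N -> shift_op (@Lx R p b N j).
Proof.
move=> jp; have hm k c := shift_op_scale c
  (shift_op_moment (@xvar R p N) (fun k => cst (b k)) j k).
have h0 := hm 0%N (xvar N j.+1 * (xvar N j.+1 + cst (b j.+1))).
have h1 := shift_op_add h0 (hm 1%N (- cst (b j.+1))).
apply: shift_op_ext (shift_op_add h1 (hm 2%N (-1))) => f.
by rewrite Lx_casimir // /level_casimir /casimir mulNr mulN1r.
Qed.

Lemma shift_opD L f g : shift_op L -> L (f + g) = L f + L g.
Proof.
case=> s h; rewrite !h /shift_sum -big_split; apply: eq_bigr => u _ /=.
by rewrite -!shift_rmorphE rmorphD mulrDr.
Qed.

Lemma shift_op_cst L c f : shift_op L -> L (cst c * f) = cst c * L f.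
Proof.
case=> s h; rewrite !h /shift_sum mulr_sumr; apply: eq_bigr => u _ /=.
by rewrite -!shift_rmorphE rmorphM !shift_rmorphE shift_cst mulrCA.
Qed.

Lemma shift_op_gen (G : (K -> K) -> Prop) L :
  (forall L, G L -> shift_op L) -> gen_algebra G L -> shift_op L.
Proof.
move=> hG; elim=> [{}L /hG //||c {}L _|{}L L' _ h _ h'|{}L L' _ h _ h'|{}L L' e _].
- exact: shift_op_id.
- exact: shift_op_scale.
- exact: shift_op_add.
- exact: shift_op_comp.
- exact: shift_op_ext.
Qed.

Lemma gen_algebra_commute (G : (K -> K) -> Prop) L M :
  shift_op M -> (forall L, G L -> M \o L =1 L \o M) ->
  gen_algebra G L -> M \o L =1 L \o M.
Proof.
move=> hM hG; elim=> [{}L /hG //||c {}L _ h|{}L L' _ h _ h'|{}L L' _ h _ h'|{}L L' e _ h]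
  f //=.
- by rewrite shift_op_cst //; congr (_ * _); exact: h.
- by rewrite shift_opD //; congr (_ + _); [exact: h | exact: h'].
- by have := h (L' f); rewrite /= => ->; congr L; exact: h'.
- by rewrite -!e; exact: h.
Qed.

Lemma gen_comm_subalgebra (G : (K -> K) -> Prop) :
  (forall L, G L -> shift_op L) ->
  (forall L L', G L -> G L' -> L \o L' =1 L' \o L) ->
  comm_subalgebra (gen_algebra G).
Proof.
move=> hG hC; split.
- by move=> L hL; apply/shift_op_diffop/(shift_op_gen hG).
- exact: gen_one.
- by move=> *; exact: gen_scale.
- by move=> *; exact: gen_add.
- by move=> *; exact: gen_comp.
- move=> L L' hL hL'; apply: gen_algebra_commute hL'; first exact: shift_op_gen hL.
  move=> M hM f; apply/esym.
  apply: (gen_algebra_commute (hG _ hM) _ hL) => M' hM'; exact: hC.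
Qed.
End DifferenceOperators.

Theorem theorem3p9 (R : realType) (p : nat) (hp : (1 <= p)%N)
    (beta : 'rV[R]_p.+2) (N : R) :
  let b := entry beta in
  [/\ forall (j : nat) (n : 'I_p -> nat),
        (1 <= j <= p)%N ->
        (forall m : nat, N = m%:R -> (\sum_(i < p) n i <= m)%N) ->
        Lx b N j (Rp n b N) = cst (mu n b j) * Rp n b N,
      forall i j : nat, (1 <= i <= p)%N -> (1 <= j <= p)%N ->
        (Lx b N i \o Lx b N j : ratfun R p -> ratfun R p)
          =1 Lx b N j \o Lx b N i
    & comm_subalgebra (@Ax R p b N)].
Proof.
move=> b; have H := @racah_shift_system R p b N.
have comm i j : (1 <= i <= p)%N -> (1 <= j <= p)%N ->
    (Lx b N i \o Lx b N j : ratfun R p -> ratfun R p) =1 Lx b N j \o Lx b N i.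
  case/andP=> _ ip /andP[_ jp] f /=; rewrite !Lx_casimir //.
  exact: (level_casimir_commute H).
split=> //; last first.
  apply: gen_comm_subalgebra => [L [j /andP[_ jp] ->]|L L' [i hi ->] [j hj ->]].
    exact: shift_op_Lx.
  exact: comm.
move=> j n /andP[j0 jp] _; have [g fg ->] := Rp_split b N n jp.
rewrite Lx_casimir // [_ * g]mulrC (level_casimirZ H) // [RHS]mulrCA; congr (_ * _).
have fx : fixed (@Eup R p) j (@xvar R p N j.+1) by exact: (fixed_x H).
have fb : fixed (@Eup R p) j (cst (b j.+1)) by exact: (fixed_b H).
have [h _] := racah_product_eigen H (fun k => oapp n 0%N (insub k)) jp fx fb.
rewrite /level_casimir h; congr (_ * _); rewrite degree_psum // /mu.
by rewrite rmorphM rmorphN !rmorphB rmorphD rmorphB !rmorph_nat rmorph1.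
Qed.
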